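(* For every function $q$ from the positive integers to the positive integers that is at most linear ($q(n)=O(n)$), there is an affine-invariant property, namely the ensemble $\mathcal{F}=\{\mathcal{F}_n\}_{n\ge1}$ with $\mathcal{F}_n=\mathrm{RM}(\lceil\log_2 q(n)\rceil,n)$, that is testable with $O(q(n))$ queries with one-sided error, but is not testable with $o(q(n))$ queries, even with two-sided error.
   Context: Every function $f:\mathbb{F}_2^n\to\mathbb{F}_2$ is uniquely a multilinear polynomial over $\mathbb{F}_2$, and $\mathrm{RM}(d,n)=\{f:\mathbb{F}_2^n\to\mathbb{F}_2:\deg f\le d\}$. A property $\mathcal{F}_n\subseteq\{\mathbb{F}_2^n\to\mathbb{F}_2\}$ is affine-invariant if $f\circ A\in\mathcal{F}_n$ for every $f\in\mathcal{F}_n$ and every affine map $A:\mathbb{F}_2^n\to\mathbb{F}_2^n$; an ensemble is affine-invariant if each $\mathcal{F}_n$ is. The distance of $f$ to $\mathcal{F}_n$ is $\delta(f,\mathcal{F}_n)=\min_{g\in\mathcal{F}_n}\Pr_x[f(x)\ne g(x)]$, with $x$ uniform in $\mathbb{F}_2^n$. A tester for $\mathcal{F}$ with proximity parameter $\delta\in(0,1]$ is a family (over $n$) of randomized oracle algorithms that, given oracle access to $f:\mathbb{F}_2^n\to\mathbb{F}_2$, accept with probability at least $2/3$ if $f\in\mathcal{F}_n$ and reject with probability at least $2/3$ if $\delta(f,\mathcal{F}_n)\ge\delta$. It has one-sided error if it accepts every $f\in\mathcal{F}_n$ with probability $1$. ''Testable with $O(q(n))$ queries'' means: for each fixed $\delta\in(0,1]$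 there is a tester with proximity parameter $\delta$ making at most $C_\delta\, q(n)$ queries for all $n$. ''Not testable with $o(q(n))$ queries'' means: there is a fixed $\delta\in(0,1]$ such that no tester with proximity parameter $\delta$ has query complexity $r(n)$ with $r(n)/q(n)\to0$ as $n\to\infty$. *)

(* Defs.v *)
From HB Require Import structures.
From mathcomp Require Import all_boot all_order all_algebra.
From mathcomp Require Import all_classical all_reals all_analysis.

Set Implicit Arguments.
Unset Strict Implicit.
Unset Printing Implicit Defensive.

Import Order.TTheory GRing.Theory Num.Theory.
Import numFieldNormedType.Exports.

Local Open Scope ring_scope.

Definition point (n : nat) := 'rV['F_2]_n.

Definition bfun (n : nat) := {ffun point n -> 'F_2}.

(* A multilinear polynomial over F_2 in n variables is given by its
   coefficients: [c S] is the coefficient of the monomial prod_(i in S) X_i. *)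
Definition mlpoly (n : nat) := {ffun {set 'I_n} -> 'F_2}.

Definition mleval (n : nat) (c : mlpoly n) : bfun n :=
  [ffun x : point n => \sum_(S : {set 'I_n}) c S * \prod_(i in S) x 0 i].

Definition mldeg (n : nat) (c : mlpoly n) : nat :=
  \max_(S : {set 'I_n} | c S != 0) #|S|%N.

Lemma mleval_inj (n : nat) : injective (@mleval n).
Proof.
move=> c c' /ffunP eq_cc'; apply/ffunP => S.
have [k leSk] := ubnP #|S|; elim: k => // k IHk in S leSk *.
have := eq_cc' (\row_i (i \in S)%:R); rewrite !ffunE.
have evS (e : mlpoly n) :
    \sum_(T : {set 'I_n}) e T * \prod_(i in T) (\row_i (i \in S)%:R : point n) 0 i
    = \sum_(T : {set 'I_n} | T \subset S) e T.
  rewrite [RHS]big_mkcond /=; apply: eq_bigr => T _.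
  case: ifPn => [sTS | /subsetPn[i iT iS]].
    by rewrite big1 ?mulr1 // => i iT; rewrite mxE (fintype.subsetP sTS).
  by rewrite (bigD1 i) //= mxE (negPf iS) mul0r mulr0.
rewrite !evS (bigD1 S) //= [RHS](bigD1 S) //=.
rewrite [X in _ + X = _](eq_bigr c') => [/addIr // | T /andP[sTS neTS]].
apply: IHk; rewrite -ltnS; apply: leq_trans leSk; rewrite ltnS.
by apply: proper_card; rewrite finset.properEneq neTS.
Qed.

Lemma mleval_surj (n : nat) (f : bfun n) : exists c, mleval c == f.
Proof.
have card_eq : (#|{: bfun n}| <= #|{: mlpoly n}|)%N.
  rewrite !card_ffun card_mx card_Fp // mul1n.
  by rewrite -cardsT -powersetT card_powerset cardsT card_ord.
by have /codomP[c ->] := inj_card_onto (@mleval_inj n) card_eq f; exists c.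
Qed.

(* The unique multilinear polynomial representing f. *)
Definition mlrep (n : nat) (f : bfun n) : mlpoly n :=
  xchoose (mleval_surj f).

Lemma mlrepK (n : nat) : cancel (@mlrep n) (@mleval n).
Proof. by move=> f; apply/eqP; exact: (xchooseP (mleval_surj f)). Qed.

Lemma mlevalK (n : nat) : cancel (@mleval n) (@mlrep n).
Proof. by move=> c; apply: mleval_inj; rewrite mlrepK. Qed.

(* The zero function gets degree 0, so it lies in every RM d n. *)
Definition deg (n : nat) (f : bfun n) : nat := mldeg (mlrep f).

Definition RM (d n : nat) : {set bfun n} := [set f : bfun n | (deg f <= d)%N].

(* One property of Boolean functions for each n; only n >= 1 is ever used. *)
Definition ensemble := forall n : nat, {set bfun n}.

(* The linear part is arbitrary: affine maps need not be invertible. *)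
Definition is_affine (n : nat) (A : point n -> point n) : Prop :=
  exists (M : 'M['F_2]_n) (b : point n), forall x, A x = x *m M + b.

Definition affine_invariant (F : ensemble) : Prop :=
  forall n : nat, (0 < n)%N ->
  forall (f : bfun n) (A : point n -> point n),
    f \in F n -> is_affine A -> [ffun x => f (A x)] \in F n.

Definition dist (R : realType) (n : nat) (f g : bfun n) : R :=
  #|[set x | f x != g x]|%:R / #|{: point n}|%:R.

(* All distances are at most 1, so for nonempty G this is their minimum; the
   distance to the empty property is 1 by convention. *)
Definition dist_to (R : realType) (n : nat) (f : bfun n) (G : {set bfun n}) : R :=
  \big[Num.min/1]_(g in G) dist R f g.

(* Deterministic adaptive oracle algorithms. [Query x t0 t1] queries the oracle
   at x and continues with t0 if the answer is 0 and with t1 if it is 1. *)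
Inductive dtree (n : nat) : Type :=
  | Output of bool
  | Query of point n & dtree n & dtree n.

Fixpoint accepts (n : nat) (t : dtree n) (f : bfun n) : bool :=
  match t with
  | Output b => b
  | Query x t0 t1 => if f x == 0 then accepts t0 f else accepts t1 f
  end.

Fixpoint nqueries (n : nat) (t : dtree n) (f : bfun n) : nat :=
  match t with
  | Output _ => 0
  | Query x t0 t1 =>
      (if f x == 0 then nqueries t0 f else nqueries t1 f).+1
  end.

(* A randomized oracle algorithm is a probability distribution over
   deterministic ones. Finite seed spaces with arbitrary real weights lose no
   generality: over a finite domain there are only finitely many deterministic
   algorithms with a given bound on the number of queries. *)
Record ralg (R : realType) (n : nat) := RAlg {
  seed : finType;
  weight : seed -> R;
  weight_ge0 : forall w, 0 <= weight w;
  weight_sum1 : \sum_w weight w = 1;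
  run : seed -> dtree n
}.

Definition accept_prob (R : realType) (n : nat) (T : ralg R n) (f : bfun n) : R :=
  \sum_(w : seed T | accepts (run w) f) weight w.

Definition reject_prob (R : realType) (n : nat) (T : ralg R n) (f : bfun n) : R :=
  \sum_(w : seed T | ~~ accepts (run w) f) weight w.

Definition query_complexity (R : realType) (n : nat) (T : ralg R n) : nat :=
  \max_(w : seed T) \max_(f : bfun n) nqueries (run w) f.

Definition is_tester (R : realType) (F : ensemble) (delta : R)
    (T : forall n, ralg R n) : Prop :=
  forall n : nat, (0 < n)%N -> forall f : bfun n,
    (f \in F n -> 2 / 3 <= accept_prob (T n) f) /\
    (delta <= dist_to R f (F n) -> 2 / 3 <= reject_prob (T n) f).

Definition one_sided (R : realType) (F : ensemble)
    (T : forall n, ralg R n) : Prop :=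
  forall n : nat, (0 < n)%N -> forall f : bfun n,
    f \in F n -> accept_prob (T n) f = 1.

Definition one_sided_testable_O (R : realType) (F : ensemble)
    (q : nat -> nat) : Prop :=
  forall delta : R, 0 < delta <= 1 ->
  exists (T : forall n, ralg R n) (C : nat),
    [/\ is_tester F delta T,
        one_sided F T
      & forall n : nat, (0 < n)%N -> (query_complexity (T n) <= C * q n)%N].

(* Testers here may have two-sided error. *)
Definition not_testable_o (R : realType) (F : ensemble)
    (q : nat -> nat) : Prop :=
  exists delta : R, 0 < delta <= 1 /\
  ~ exists T : forall n, ralg R n,
      is_tester F delta T /\
      ((((query_complexity (T n))%:R / (q n)%:R)%R : R) @[n --> \oo]
         --> (0%R : R))%classic.

(* Main.v *)
From mathcomp Require Import all_boot all_order all_algebra.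
From mathcomp Require Import all_classical all_reals all_analysis.
From mathcomp Require Import zify ring lra.
(* Imported last because all_classical also defines [point]. *)
Require Import Defs.

(* Write d = ceil(log_2 (q n)), so that q n <= 2^d <= 2 q n.

   Upper bound (after Bhattacharyya, Kopparty, Schoenebeck, Sudan and
   Zuckerman): restrict f to a random affine subspace of dimension d + 3,
   reached through a chain of random hyperplanes, and check the degree there.
   If f is within 2^-(d+1) of some g in RM d n, a second moment argument shows
   that with good probability the subspace contains at least one but fewer than
   8 points where f and g differ, so that the restriction has degree > d.
   Otherwise at most 2^(d+2) hyperplanes carry a polynomial of degree <= d that
   is 2^-(d+3)-close to f, because the polynomials on more hyperplanes than that
   would glue to one on the whole space that is 2^-(d+1)-close to f; hence f
   stays far from RM d on all but a 2^(d+2-n) fraction of the hyperplanes, and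
   induction on n loses only a convergent product.

   Lower bound: on any 2^d points the polynomials of degree <= d take all
   values, so fewer queries cannot distinguish a random g in RM d n from f0 + g;
   when d < n / 2 a counting argument gives an f0 at distance at least 1/16 from
   RM d n. *)

Set Implicit Arguments.
Unset Strict Implicit.
Unset Printing Implicit Defensive.

Import Order.TTheory GRing.Theory Num.Theory.

Local Open Scope ring_scope.

(** * Degree and iterated differences *)

Definition fdiff n (e : point n) (f : point n -> 'F_2) : point n -> 'F_2 :=
  fun x => f (x + e) - f x.

(* [deglt k f] means deg f < k; see [RM_deglt]. *)
Fixpoint deglt n k (f : point n -> 'F_2) : Prop :=
  if k is k'.+1 then forall e, deglt k' (fdiff e f) else forall x, f x = 0.

Arguments deglt : simpl never.

Lemma eq_deglt n k (f g : point n -> 'F_2) : f =1 g -> deglt k f -> deglt k g.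
Proof.
elim: k f g => [|k IHk] f g fg /=; first by move=> f0 x; rewrite -fg.
by move=> df e; apply: IHk (df e) => x; rewrite /fdiff !fg.
Qed.

Lemma deglt_zero n k : deglt k (fun _ : point n => 0).
Proof.
elim: k => //= k IHk e.
by apply: eq_deglt IHk => x; rewrite /fdiff subrr.
Qed.

Lemma degltD n k (f g : point n -> 'F_2) :
  deglt k f -> deglt k g -> deglt k (fun x => f x + g x).
Proof.
elim: k f g => [|k IHk] f g /=; first by move=> f0 g0 x; rewrite f0 g0 addr0.
move=> df dg e; apply: eq_deglt (IHk _ _ (df e) (dg e)) => x.
by rewrite /fdiff opprD addrACA.
Qed.

Lemma degltZ n k (c : 'F_2) (f : point n -> 'F_2) :
  deglt k f -> deglt k (fun x => c * f x).
Proof.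
elim: k f => [|k IHk] f /=; first by move=> f0 x; rewrite f0 mulr0.
by move=> df e; apply: eq_deglt (IHk _ (df e)) => x; rewrite /fdiff mulrBr.
Qed.

Lemma degltB n k (f g : point n -> 'F_2) :
  deglt k f -> deglt k g -> deglt k (fun x => f x - g x).
Proof.
move=> df dg; apply: eq_deglt (degltD df (degltZ (-1) dg)) => x.
by rewrite mulN1r.
Qed.

Lemma deglt_sum n k (I : Type) (s : seq I) (P : pred I)
    (f : I -> point n -> 'F_2) :
  (forall i, P i -> deglt k (f i)) ->
  deglt k (fun x => \sum_(i <- s | P i) f i x).
Proof.
move=> df; elim: s => [|i s IHs].
  by apply: eq_deglt (deglt_zero n k) => x; rewrite big_nil.
have [Pi|nPi] := boolP (P i).
  by apply: eq_deglt (degltD (df i Pi) IHs) => x; rewrite big_cons Pi.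
by apply: eq_deglt IHs => x; rewrite big_cons (negPf nPi).
Qed.

Lemma degltS n k (f : point n -> 'F_2) : deglt k f -> deglt k.+1 f.
Proof.
elim: k f => [|k IHk] f.
  by move=> f0 e x; rewrite /fdiff !f0 subrr.
by move=> df e; apply: IHk (df e).
Qed.

Lemma deglt_leq n k l (f : point n -> 'F_2) :
  (k <= l)%N -> deglt k f -> deglt l f.
Proof.
move=> lekl df; rewrite -(subnK lekl).
by elim: (l - k)%N => // m IHm; rewrite addSn; apply: degltS.
Qed.

Lemma deglt_const n (c : 'F_2) : deglt 1 (fun _ : point n => c).
Proof. by move=> e x; rewrite /fdiff subrr. Qed.

(** [A] is affine with linear part [A']: the difference of f o A along e is the difference of f
    along A' e, composed with [A]. *)
Lemma deglt_comp n p k (A A' : point p -> point n) (f : point n -> 'F_2) :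
  (forall x e, A (x + e) = A x + A' e) ->
  deglt k f -> deglt k (fun x => f (A x)).
Proof.
move=> AE; elim: k f => [|k IHk] f /=; first by move=> f0 x; exact: f0.
by move=> df e; apply: eq_deglt (IHk _ (df (A' e))) => x; rewrite /fdiff AE.
Qed.

(** Product rule: the difference of L h along e is L times the difference of h, plus l(e) h(x +
    e). *)
Lemma deglt_mul_affine n k (L l h : point n -> 'F_2) :
  (forall x e, L (x + e) = L x + l e) ->
  deglt k h -> deglt k.+1 (fun x => L x * h x).
Proof.
move=> LE; elim: k h => [|k IHk] h.
  by move=> h0 e x; rewrite /fdiff !h0 !mulr0 subrr.
move=> dh e.
have dhe : deglt k.+1 (fun x => h (x + e)).
  by apply: (@deglt_comp _ _ _ _ id) dh => x u; rewrite addrAC.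
apply: eq_deglt (degltD (IHk _ (dh e)) (degltZ (l e) dhe)) => x.
by rewrite /fdiff LE; ring.
Qed.

Lemma deglt_monomial n (s : seq 'I_n) :
  deglt (size s).+1 (fun x : point n => \prod_(i <- s) x 0 i).
Proof.
elim: s => [|i s IHs] /=.
  by apply: (eq_deglt _ (@deglt_const n 1)) => x; rewrite big_nil.
have Xi (x e : point n) : (x + e) 0 i = x 0 i + e 0 i by rewrite mxE.
by apply: (eq_deglt _ (deglt_mul_affine Xi IHs)) => x; rewrite big_cons.
Qed.

(** Differencing along a unit vector is formal differentiation: monomials without X_i cancel, the
    others lose X_i. *)
Lemma fdiff_mleval n (c : mlpoly n) (i : 'I_n) x :
  fdiff (delta_mx 0 i) (mleval c) x =
  mleval [ffun T : {set 'I_n} => if i \in T then 0 else c (i |: T)] x.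
Proof.
rewrite /fdiff !ffunE -sumrB (bigID (fun S : {set 'I_n} => i \in S)) /=.
rewrite [X in _ + X]big1 ?addr0; last first.
  move=> S iS; rewrite -mulrBr (_ : _ - _ = 0) ?mulr0 //.
  apply/eqP; rewrite subr_eq0; apply/eqP/eq_bigr => j jS.
  rewrite !mxE /= (_ : (j == i) = false) ?addr0 //.
  by apply/negP => /eqP ji; rewrite -ji jS in iS.
rewrite [RHS](bigID (fun S : {set 'I_n} => i \in S)) /=.
rewrite [X in _ = X + _]big1 ?add0r; last first.
  by move=> S iS; rewrite ffunE iS mul0r.
rewrite (reindex_onto (fun T => i |: T) (fun S => S :\ i)) /=; last first.
  by move=> S iS; rewrite finset.setD1K.
have -> : \sum_(T : {set 'I_n} | (i \in i |: T) && ((i |: T) :\ i == T))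
    (c (i |: T) * \prod_(j in i |: T) (x + delta_mx 0 i) 0 j -
     c (i |: T) * \prod_(j in i |: T) x 0 j) =
  \sum_(T : {set 'I_n} | i \notin T) (c (i |: T) * \prod_(j in i |: T) (x + delta_mx 0 i) 0 j -
     c (i |: T) * \prod_(j in i |: T) x 0 j).
  apply: eq_bigl => T; rewrite setU11 /=; apply/eqP/idP => [<-|iT].
    by rewrite finset.setD11.
  by rewrite setU1K.
apply: eq_bigr => T iT; rewrite ffunE (negPf iT) !big_setU1 //= !mxE !eqxx /=.
rewrite (eq_bigr (fun j => x 0 j)); first by ring.
move=> j jT; rewrite !mxE /= (_ : (j == i) = false) ?addr0 //.
by apply/negP => /eqP ji; rewrite -ji jT in iT.
Qed.

(** Differentiating along some i in S moves the coefficient of S to that of S minus i; after k steps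
    the polynomial is zero. *)
Lemma deglt_coef n k (c : mlpoly n) (S : {set 'I_n}) :
  deglt k (mleval c) -> (k <= #|S|)%N -> c S = 0.
Proof.
elim: k c S => [|k IHk] c S dc.
  move=> _; have -> : c = [ffun=> 0]; last by rewrite ffunE.
  apply: mleval_inj; apply/ffunP => x; rewrite dc !ffunE big1 // => T _.
  by rewrite ffunE mul0r.
move=> kS; have /card_gt0P[i iS] : (0 < #|S|)%N by apply: leq_trans kS.
have := IHk [ffun T : {set 'I_n} => if i \in T then 0 else c (i |: T)] (S :\ i).
rewrite ffunE finset.setD11 finset.setD1K // => -> //.
  by apply: eq_deglt (dc (delta_mx 0 i)); apply: fdiff_mleval.
by move: kS; rewrite (cardsD1 i) iS.
Qed.

Lemma RM_deglt d n (f : bfun n) : f \in RM d n <-> deglt d.+1 f.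
Proof.
rewrite inE /deg /mldeg; split=> [/bigmax_leqP degf | df].
  rewrite -{1}(mlrepK f).
  apply: (@eq_deglt _ _ (fun x => \sum_(S : {set 'I_n} | mlrep f S != 0)
                           mlrep f S * \prod_(i <- enum S) x 0 i)).
    move=> x; rewrite ffunE [RHS](bigID (fun S => mlrep f S != 0)) /=.
    rewrite [X in _ + X]big1 ?addr0; last first.
      by move=> S /negPn/eqP ->; rewrite mul0r.
    by apply: eq_bigr => S _; rewrite big_enum.
  apply: deglt_sum => S cS; apply: degltZ.
  by apply: deglt_leq (deglt_monomial _); rewrite -cardE ltnS degf.
apply/bigmax_leqP => S cS; rewrite leqNgt; apply/negP => dS.
by case/eqP: cS; apply: deglt_coef dS; rewrite mlrepK.
Qed.

(** * Minimum weight of low-degree polynomials *)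

Definition wt n (f : point n -> 'F_2) : nat := #|[set x | f x != 0]|.

(** The support of a difference lies in the union of the support of f and a translate of it, so each
    difference at most doubles the weight. *)
Lemma deglt_min_wt n k (f : point n -> 'F_2) :
  deglt k f -> (exists x, f x != 0) -> (2 * 2 ^ n <= 2 ^ k * wt f)%N.
Proof.
have cardN : #|{: point n}| = (2 ^ n)%N by rewrite card_mx card_Fp // mul1n.
elim: k f => [|k IHk] f df [x0 fx0]; first by rewrite df eqxx in fx0.
have [[e nz]|zero] := pselect (exists e, exists x, fdiff e f x != 0).
  apply: leq_trans (IHk _ (df e) nz) _; rewrite expnS [(2 * _)%N]mulnC -mulnA.
  rewrite leq_mul2l; apply/orP; right.
  have -> : (2 * wt f = #|[set x | f x != 0%R]| + #|(fun x => (x - e)%R) @: [set x | f x != 0%R]|)%N.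
    by rewrite card_imset ?addnn ?mul2n //; apply: addIr.
  apply: leq_trans (leq_card_setU _ _); apply: subset_leq_card.
  apply/fintype.subsetP => x; rewrite !inE /fdiff => nzx.
  have [/eqP fx|//] := boolP (f x == 0).
  apply/imsetP; exists (x + e); last by rewrite addrK.
  by rewrite inE; move: nzx; rewrite fx subr0.
(* All differences vanish, so f is a nonzero constant. *)
have -> : wt f = (2 ^ n)%N.
  rewrite /wt -cardN -cardsT; congr #|pred_of_set _|; apply/setP => x.
  rewrite !inE; suff -> : f x = f x0 by [].
  apply/eqP; rewrite -subr_eq0; apply/negPn/negP => nz.
  by case: zero; exists (x - x0), x0; rewrite /fdiff (addrC x0) subrK.
by rewrite expnS leq_mul2r leq_pmulr ?expn_gt0 ?orbT.
Qed.

(** * Hyperplanes *)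

Lemma card_point n : #|{: point n}| = (2 ^ n)%N.
Proof. by rewrite card_mx card_Fp // mul1n. Qed.

Lemma F2_neq0 (c : 'F_2) : c != 0 -> c = 1.
Proof. by case: c => [[|[|//]] i] // _; apply: val_inj. Qed.

Lemma F2_addxx (c : 'F_2) : c + c = 0.
Proof. by case: c => [[|[|//]] i]; apply: val_inj. Qed.

Lemma point_addxx n (x : point n) : x + x = 0.
Proof. by apply/rowP => i; rewrite !mxE F2_addxx. Qed.

Definition dot n (a x : point n) : 'F_2 := (a *m x^T) 0 0.

Definition hplane n (p : point n * 'F_2) : {set point n} :=
  [set x | dot p.1 x == p.2].

(** Over F_2 a nonzero normal is unique, so [hyp n] lists each affine hyperplane exactly once. *)
Definition hyp n : {set point n * 'F_2} := [set p | p.1 != 0].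

Lemma dotC n (a x : point n) : dot a x = dot x a.
Proof. by rewrite /dot -[a *m _]trmxK trmx_mul trmxK mxE. Qed.

Lemma dotDr n (a x y : point n) : dot a (x + y) = dot a x + dot a y.
Proof. by rewrite /dot linearD mulmxDr mxE. Qed.

Lemma dotE n (a x : point n) : dot a x = \sum_i a 0 i * x 0 i.
Proof. by rewrite /dot mxE; apply: eq_bigr => i _; rewrite mxE. Qed.

Lemma dot0 n (a : point n) : dot a 0 = 0.
Proof. by rewrite dotE big1 // => i _; rewrite mxE mulr0. Qed.

(** The cokernel of A detects that a is outside the row space; a column of [cokermx A] on which a is
    nonzero serves as e. *)
Lemma dual_vector r n (A : 'M['F_2]_(r, n)) (a : point n) :
  ~~ (a <= A)%MS -> exists e : point n, A *m e^T = 0 /\ dot a e = 1.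
Proof.
rewrite submxE => nz.
have /existsP[j nzj] : [exists j, (a *m cokermx A) 0 j != 0].
  apply: contraNT nz => /existsPn z; apply/eqP/rowP => j.
  by rewrite [RHS]mxE; apply/eqP/negPn/z.
exists (col j (cokermx A))^T; rewrite trmxK; split.
  by rewrite colE mulmxA mulmx_coker mul0mx.
by apply: F2_neq0; rewrite /dot trmxK colE mulmxA -colE mxE.
Qed.

(** Translation by e swaps the points of W on the hyperplane with those off it. *)
Lemma card_setI_hplane n (W : {set point n}) (a e : point n) (c : 'F_2) :
  dot a e = 1 -> (forall x, x \in W -> x + e \in W) ->
  (2 * #|W :&: hplane (a, c)| = #|W|)%N.
Proof.
move=> ae We; rewrite -(cardsID (hplane (a, c)) W) mul2n -addnn; congr (_ + _)%N.
rewrite -(card_imset (fun x => x \in W :&: hplane (a, c)) (addIr e)).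
apply: eq_card => x; rewrite !inE /=; apply/imsetP/andP.
  case=> y; rewrite !inE /= => /andP[yW /eqP yc] ->; rewrite We // dotDr yc ae.
  by rewrite -subr_eq0 addrAC subrr add0r oner_neq0.
case=> xc xW; exists (x + e); last by rewrite -addrA point_addxx addr0.
rewrite !inE /= We //= dotDr ae; rewrite -subr_eq0 in xc.
by rewrite -subr_eq0 addrAC (F2_neq0 xc) F2_addxx.
Qed.

Lemma card_hplane n (p : point n * 'F_2) :
  p \in hyp n -> (2 * #|hplane p| = 2 ^ n)%N.
Proof.
case: p => a c; rewrite inE /= => nza.
have [e ae] : exists e, dot a e = 1.
  have /existsP[i nzi] : [exists i, a 0 i != 0].
    apply: contraNT nza => /existsPn z; apply/eqP/rowP => i.
    by rewrite [RHS]mxE; apply/eqP/negPn/z.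
  exists (delta_mx 0 i); apply: F2_neq0.
  by rewrite /dot trmx_delta -colE mxE.
rewrite -card_point -cardsT -(card_setI_hplane c ae (W := [set: point n])).
  by rewrite finset.setTI.
by move=> x _; rewrite inE.
Qed.

(** Distinct parallel hyperplanes are disjoint; for different normals, translation by a suitable e
    preserves the first hyperplane, which the second one therefore halves. *)
Lemma card_hplaneI n (p p' : point n * 'F_2) :
  p \in hyp n -> p' \in hyp n -> p != p' ->
  (4 * #|hplane p :&: hplane p'| <= 2 ^ n)%N.
Proof.
case: p p' => [a c] [a' c'] hp hp'; have [<-|neaa'] := eqVneq a a'.
  have [-> /eqP//|necc' _] := eqVneq c c'.
  rewrite (_ : _ :&: _ = finset.set0) ?cards0 //; apply/setP => x.
  by rewrite !inE /=; apply: contraNF necc' => /andP[/eqP<- /eqP<-].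
move=> _; have [|e [ae a'e]] := @dual_vector 1 n a a'.
  apply/sub_rVP => -[k a'k]; move: hp'; rewrite inE /= a'k.
  have [->|/F2_neq0 k1] := eqVneq k 0; first by rewrite scale0r eqxx.
  by move: neaa'; rewrite a'k k1 scale1r eqxx.
rewrite -(card_hplane hp) -(card_setI_hplane c' a'e (W := hplane (a, c))).
  by rewrite mulnA.
by move=> x; rewrite !inE /= dotDr [dot a e](_ : _ = 0) ?addr0 // /dot ae mxE.
Qed.

Lemma card_hyp n : #|hyp n| = (2 * (2 ^ n - 1))%N.
Proof.
have -> : hyp n = finset.setX [set~ 0] [set: 'F_2].
  by apply/setP => p; rewrite !inE andbT.
by rewrite cardsX cardsC1 card_point cardsT card_Fp // mulnC subn1.
Qed.

Lemma card_hyp_through n (x : point n) :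
  #|[set p in hyp n | x \in hplane p]| = (2 ^ n - 1)%N.
Proof.
have inj : injective (fun a : point n => (a, dot a x)) by move=> a b [].
rewrite -card_point subn1 -(cardsC1 (0 : point n)) -(card_imset _ inj).
apply: eq_card => -[a c]; rewrite !inE /=; apply/andP/imsetP.
  by case=> nza /eqP <-; exists a; rewrite ?inE.
by case=> b; rewrite !inE => nzb [-> ->]; rewrite eqxx.
Qed.

(** Hyperplanes through both points correspond to the nonzero normals orthogonal to x - y; the
    successor counts the zero normal. *)
Lemma card_hyp_through2 n (x y : point n) : x != y ->
  (2 * #|[set p in hyp n | (x \in hplane p) && (y \in hplane p)]|.+1 = 2 ^ n)%N.
Proof.
move=> nexy; have inj : injective (fun a : point n => (a, dot a x)).
  by move=> a b [].
have hxy : (x - y, 0) \in hyp n by rewrite inE subr_eq0.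
rewrite -(card_hplane hxy) (cardsD1 0 (hplane (x - y, 0))) inE /= dot0 eqxx.
rewrite -(card_imset _ inj); congr (2 * _.+1)%N.
apply: eq_card => -[a c]; rewrite !inE /=; apply/and3P/imsetP.
  case=> nza /eqP ax /eqP ay; exists a; last by rewrite ax.
  by rewrite !inE nza /= dotC -[_ == _]orbF; move: (dotDr a (x - y) y);
     rewrite subrK ax ay -{1}(add0r c) => /addIr <-; rewrite eqxx.
case=> b; rewrite !inE /= dotC => /andP[nzb /eqP bxy] [-> ->].
split=> //; move: (dotDr b (x - y) y).
by rewrite subrK bxy add0r => <-.
Qed.

(** * Coordinates on a hyperplane *)

Definition pivot n (a : point n.+1) : 'I_n.+1 :=
  odflt ord0 [pick i | a 0 i != 0].

Lemma pivotP n (a : point n.+1) : a != 0 -> a 0 (pivot a) = 1.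
Proof.
rewrite /pivot; case: pickP => [i /F2_neq0 //|z /eqP[]].
by apply/rowP => i; rewrite mxE; apply/eqP/negbFE/z.
Qed.

(* Parametrizes the hyperplane dot a x = c by all coordinates but the pivot
   of a. *)
Definition hpar n (p : point n.+1 * 'F_2) (y : point n) : point n.+1 :=
  \row_t if unlift (pivot p.1) t is Some j then y 0 j
         else p.2 - \sum_j p.1 0 (lift (pivot p.1) j) * y 0 j.

(** Being defined on the whole space, this also extends a polynomial from the hyperplane without
    raising its degree. *)
Definition hproj n (p : point n.+1 * 'F_2) (x : point n.+1) : point n :=
  \row_j x 0 (lift (pivot p.1) j).

Lemma hparD n (p : point n.+1 * 'F_2) (y e : point n) :
  hpar p (y + e) = hpar p y + hpar (p.1, 0) e.
Proof.
apply/rowP => t; rewrite !mxE /=; case: unliftP => [j _|_]; first by rewrite mxE.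
rewrite sub0r -addrA -opprD -big_split /=; congr (_ - _).
by apply: eq_bigr => j _; rewrite mxE mulrDr.
Qed.

Lemma hprojD n (p : point n.+1 * 'F_2) (x e : point n.+1) :
  hproj p (x + e) = hproj p x + hproj p e.
Proof. by apply/rowP => j; rewrite !mxE. Qed.

Lemma hpar_in n (p : point n.+1 * 'F_2) y : p \in hyp n.+1 -> hpar p y \in hplane p.
Proof.
rewrite !inE => /pivotP a1; rewrite dotE (bigD1_ord (pivot p.1)) //= a1 mul1r.
rewrite mxE unlift_none [X in _ + X](eq_bigr (fun j => p.1 0 (lift (pivot p.1) j) * y 0 j)).
  by rewrite subrK.
by move=> j _; rewrite mxE liftK.
Qed.

Lemma hparK n (p : point n.+1 * 'F_2) : cancel (hpar p) (hproj p).
Proof. by move=> y; apply/rowP => j; rewrite !mxE liftK. Qed.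

Lemma hprojK n (p : point n.+1 * 'F_2) :
  p \in hyp n.+1 -> {in hplane p, cancel (hproj p) (hpar p)}.
Proof.
rewrite inE => /pivotP a1 x; rewrite inE => /eqP ax.
apply/rowP => t; rewrite !mxE; case: unliftP => [j ->|->]; first by rewrite mxE.
move: ax; rewrite dotE (bigD1_ord (pivot p.1)) //= a1 mul1r => <-.
rewrite [X in _ - X](eq_bigr (fun j => p.1 0 (lift (pivot p.1) j) * x 0 (lift (pivot p.1) j))).
  by rewrite addrK.
by move=> j _; rewrite mxE.
Qed.

Lemma card_hpar n (p : point n.+1 * 'F_2) (Z : pred (point n.+1)) :
  p \in hyp n.+1 ->
  #|[set y | Z (hpar p y)]| = #|[set x in hplane p | Z x]|.
Proof.
move=> hp; rewrite -(card_imset _ (can_inj (@hparK n p))).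
apply: eq_card => x; rewrite !inE; apply/imsetP/andP.
  by case=> y; rewrite inE => Zy ->; split=> //; have := hpar_in y hp; rewrite inE.
case=> xp Zx; have xK : hpar p (hproj p x) = x by rewrite hprojK // inE.
by exists (hproj p x); rewrite ?inE xK.
Qed.

(** * Gluing polynomials given on hyperplanes *)

(* The indicator function of [hplane p], as an affine form. *)
Definition hind n (p : point n * 'F_2) (x : point n) : 'F_2 :=
  dot p.1 x - p.2 + 1.

Lemma hindD n (p : point n * 'F_2) x e : hind p (x + e) = hind p x + dot p.1 e.
Proof. by rewrite /hind dotDr; ring. Qed.

Lemma hind_neq0 n (p : point n * 'F_2) x : (hind p x != 0) = (x \in hplane p).
Proof.
rewrite inE /hind; have [->|ne] := eqVneq (dot p.1 x) p.2.
  by rewrite subrr add0r oner_eq0.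
by rewrite (F2_neq0 (c := dot p.1 x - p.2)) ?subr_eq0 // F2_addxx eqxx.
Qed.

(** The product of both hyperplane indicators with P - P' has degree at most d + 2, so if nonzero it
    has weight at least 2^n / 2^(d+2); but its support lies in the two disagreement sets, together
    smaller than 2^n / 2^(d+3). *)
Lemma agree_on_hplaneI n d (f P P' : point n -> 'F_2) (p p' : point n * 'F_2) :
  deglt d.+1 P -> deglt d.+1 P' ->
  (16 * 2 ^ d * #|[set x in hplane p | f x != P x]| < 2 ^ n)%N ->
  (16 * 2 ^ d * #|[set x in hplane p' | f x != P' x]| < 2 ^ n)%N ->
  forall x, x \in hplane p -> x \in hplane p' -> P x = P' x.
Proof.
move=> dP dP' cP cP' x xp xp'; apply/eqP/negPn/negP => neP.
have nz : exists y, hind p y * (hind p' y * (P y - P' y)) != 0.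
  by exists x; rewrite !mulf_neq0 ?hind_neq0 ?subr_eq0.
have := deglt_min_wt (deglt_mul_affine (hindD p)
          (deglt_mul_affine (hindD p') (degltB dP dP'))) nz.
apply/negP; rewrite -ltnNge.
have : (wt (fun x => (hind p x * (hind p' x * (P x - P' x)))%R) <=
   #|[set x in hplane p | f x != P x]| + #|[set x in hplane p' | f x != P' x]|)%N.
  apply: leq_trans (leq_card_setU _ _); apply: subset_leq_card.
  apply/fintype.subsetP => y; rewrite !inE !mulf_eq0 !negb_or !hind_neq0 !inE.
  by rewrite subr_eq0 => /and3P[-> -> /=]; case: (f y =P P y) => [->|].
rewrite !expnS; set D := (2 ^ d)%N in cP cP' *; nia.
Qed.

Definition uncovered n (S : {set point n * 'F_2}) : {set point n} :=
  [set x | [forall p in S, x \notin hplane p]].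

Section Gluing.

Variables (n d : nat) (f : point n -> 'F_2).
Variables (J : {set point n * 'F_2}) (P : point n * 'F_2 -> point n -> 'F_2).
(** This size leaves room for d + 2 hyperplanes with independent normals. *)
Hypothesis J_large : (2 ^ d.+2 < #|J|)%N.
Hypothesis deg_P : forall p, p \in J -> deglt d.+1 (P p).
Hypothesis P_close : forall p, p \in J ->
  (16 * 2 ^ d * #|[set x in hplane p | f x != P p x]| < 2 ^ n)%N.

(** Greedy choice: the rows of [A] hold the normals chosen so far, each new normal is independent of
    them, and each new hyperplane halves the uncovered set. *)
Lemma glue_independent r : (r <= d.+2)%N ->
  exists (S : {set point n * 'F_2}) (A : 'M['F_2]_(r, n)) (Q : point n -> 'F_2),
    [/\ S \subset J, forall p, p \in S -> (p.1 <= A)%MS, deglt d.+1 Q,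
        forall p x, p \in S -> x \in hplane p -> Q x = P p x
      & (2 ^ r * #|uncovered S| <= 2 ^ n)%N].
Proof.
elim: r => [|r IHr] ltrd.
  exists finset.set0, 0, (fun _ => 0); split; rewrite ?finset.sub0set //.
  - by move=> p; rewrite inE.
  - exact: deglt_zero.
  - by move=> p x; rewrite inE.
  by rewrite expn0 mul1n -(card_point n) max_card.
have [S [A [Q [SJ SA dQ QP US]]]] := IHr (ltnW ltrd).
(* If all normals of J lay in the row space of A, J would have at most 2^r normals with 2 offsets
   each, hence at most 2^(d+2) elements. *)
have [p pJ pA] : exists2 p, p \in J & ~~ (p.1 <= A)%MS.
  apply/exists_inP; apply: contraTT J_large => /exists_inPn JA; rewrite -leqNgt.
  pose comb (v : point r * 'F_2) : point n * 'F_2 := (v.1 *m A, v.2).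
  apply: (@leq_trans #|comb @: [set: point r * 'F_2]|).
    apply: subset_leq_card; apply/fintype.subsetP => -[a c] acJ.
    have := JA _ acJ; rewrite negbK => /submxP[u /= ->].
    by apply/imsetP; exists (u, c); rewrite ?inE.
  apply: leq_trans (leq_imset_card _ _) _.
  by rewrite cardsT card_prod card_point card_Fp // -expnSr leq_exp2l.
have [e [Ae pe]] := dual_vector pA.
have Se i : i \in S -> dot i.1 e = 0.
  by case/SA/submxP => u iu; rewrite /dot iu -mulmxA Ae mulmx0 mxE.
(* The projection onto [hplane p] along e preserves the hyperplanes of S, so
   adding (P p - Q) o pi corrects Q on [hplane p] only. *)
pose pi x := x - (dot p.1 x - p.2) *: e.
have piD x y : pi (x + y) = pi x + (y - dot p.1 y *: e).
  by rewrite /pi dotDr (addrAC (dot _ _)) scalerDl opprD addrACA.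
have dotZ a k : dot a (k *: e) = k * dot a e.
  by rewrite /dot linearZ -scalemxAr mxE.
have dotN a y : dot a (- y) = - dot a y.
  by rewrite -scaleN1r /dot linearZ -scalemxAr mxE mulN1r.
have pi_p x : pi x \in hplane p.
  by rewrite inE dotDr dotN dotZ pe mulr1 subKr.
have pi_S i x : i \in S -> (pi x \in hplane i) = (x \in hplane i).
  by move=> iS; rewrite !inE dotDr dotN dotZ Se // mulr0 oppr0 addr0.
have pi_id x : x \in hplane p -> pi x = x.
  by rewrite inE /pi => /eqP ->; rewrite subrr scale0r subr0.
exists (p |: S), (col_mx p.1 A), (fun x => Q x + (P p (pi x) - Q (pi x))); split.
- by rewrite finset.subUset finset.sub1set pJ.
- move=> i /setU1P[->|iS]; first by have := submx_refl (col_mx p.1 A); rewrite col_mx_sub => /andP[].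
  apply: submx_trans (SA i iS) _.
  by have := submx_refl (col_mx p.1 A); rewrite col_mx_sub => /andP[].
- apply: (degltD dQ); apply: (deglt_comp (f := fun y => P p y - Q y) piD).
  by apply: degltB => //; apply: deg_P.
- move=> i x /setU1P[->|iS] xi; first by rewrite (pi_id x xi) addrC subrK.
  (* On a hyperplane i of S the correction vanishes: pi x lies on p and on i, where [P p] and [P i]
     agree. *)
  rewrite (QP i (pi x) iS) ?pi_S // (QP i x iS xi).
  have iJ := fintype.subsetP SJ i iS.
  rewrite (agree_on_hplaneI (deg_P pJ) (deg_P iJ) (P_close pJ) (P_close iJ) (pi_p x)).
    by rewrite subrr addr0.
  by rewrite pi_S.
apply: leq_trans US; rewrite expnSr -mulnA leq_mul2l; apply/orP; right.
(* Translation by e preserves the uncovered set; what stays uncovered lies on the parallel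
   hyperplane with offset p.2 + 1. *)
rewrite -(@card_setI_hplane n (uncovered S) p.1 e (p.2 + 1) pe).
  rewrite leq_mul2l /=; apply: subset_leq_card; apply/fintype.subsetP => x.
  rewrite !inE => /forall_inP ux; apply/andP; split.
    by apply/forall_inP => i iS; apply: ux; rewrite setU1r.
  have := ux p (setU11 _ _); rewrite inE -subr_eq0 => /F2_neq0 /=.
  by move/eqP; rewrite subr_eq addrC.
move=> x; rewrite !inE => /forall_inP ux; apply/forall_inP => i iS.
by have := ux i iS; rewrite !inE dotDr Se // addr0.
Qed.

(** At most 2^n / 2^(d+2) points lie off the chosen hyperplanes, too few to support a nonzero
    polynomial of degree d + 1 such as [P p] - Q times the indicator of p. *)
Lemma glue : exists2 Q, deglt d.+1 Q &
  forall p x, p \in J -> x \in hplane p -> Q x = P p x.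
Proof.
have [S [A [Q [SJ _ dQ QP US]]]] := glue_independent (leqnn _).
exists Q => // p x pJ xp; apply/eqP; rewrite eq_sym; apply/negPn/negP => neQ.
have nz : exists y, hind p y * (P p y - Q y) != 0.
  by exists x; rewrite mulf_neq0 ?hind_neq0 ?subr_eq0.
have := deglt_min_wt (deglt_mul_affine (hindD p) (degltB (deg_P pJ) dQ)) nz.
apply/negP; rewrite -ltnNge.
have : (wt (fun x => (hind p x * (P p x - Q x))%R) <= #|uncovered S|)%N.
  apply: subset_leq_card; apply/fintype.subsetP => y.
  rewrite inE mulf_eq0 negb_or hind_neq0 subr_eq0 => /andP[yp neqy].
  rewrite inE; apply/forall_inP => i iS; apply: contra neqy => yi.
  have iJ := fintype.subsetP SJ i iS.
  rewrite (QP i y iS yi).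
  by rewrite (agree_on_hplaneI (deg_P pJ) (deg_P iJ) (P_close pJ) (P_close iJ) yp).
have : (0 < 2 ^ n)%N by rewrite expn_gt0.
by set N := (2 ^ n)%N in US *; set D := (2 ^ d.+2)%N in US *; nia.
Qed.

Hypothesis J_hyp : J \subset hyp n.

(** Second moment method: two hyperplanes share at most a quarter of the space, so the number m x of
    hyperplanes of J through x is close to K / 2 for most x; a large E would then meet them too
    often for [P_close]. *)
Lemma card_disagree_hplanes (Q : point n -> 'F_2) :
  (forall p x, p \in J -> x \in hplane p -> Q x = P p x) ->
  (2 * 2 ^ d * #|[set x | f x != Q x]| <= 2 ^ n)%N.
Proof.
move=> QP; set E := [set x | _].
pose h (p : point n * 'F_2) (x : point n) : int := (x \in hplane p)%:R.
pose m (x : point n) := \sum_(p in J) h p x.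
pose K : int := #|J|%:R; pose N : int := (2 ^ n)%N%:R; pose D : int := (2 ^ d)%N%:R.
have sum_card (W : {set point n}) : \sum_x (x \in W)%:R = #|W|%:R :> int.
  by rewrite -sum1_card natr_sum [RHS]big_mkcond; apply: eq_bigr => x _; case: (x \in W).
have sum_h p : p \in J -> 2 * \sum_x h p x = N.
  move=> pJ; rewrite sum_card -natrM card_hplane //.
  exact: (fintype.subsetP J_hyp).
have sum_hh p p' : p \in J -> p' \in J -> p != p' ->
    4 * \sum_x h p x * h p' x <= N.
  move=> pJ p'J ne; rewrite (eq_bigr (fun x => (x \in hplane p :&: hplane p')%:R)).
    by rewrite sum_card -natrM ler_nat card_hplaneI // (fintype.subsetP J_hyp).
  by move=> x _; rewrite /h -natrM mulnb finset.in_setI.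
have sum_m : 2 * \sum_x m x = K * N.
  rewrite /m exchange_big mulr_sumr (eq_bigr (fun _ => N)) /=; last exact: sum_h.
  by rewrite sumr_const -mulr_natl.
have sum_m2 : 4 * \sum_x m x ^+ 2 <= K * (K + 1) * N.
  have -> : \sum_x m x ^+ 2 = \sum_(p in J) \sum_(p' in J) \sum_x h p x * h p' x.
    rewrite exchange_big /= [RHS](eq_bigr (fun p' => \sum_x m x * h p' x)).
      rewrite exchange_big; apply: eq_bigr => x _.
      by rewrite -mulr_sumr expr2.
    by move=> p' _; rewrite exchange_big; apply: eq_bigr => x _; rewrite mulr_suml.
  rewrite mulr_sumr; have -> : K * (K + 1) * N = \sum_(p in J) (K + 1) * N.
    by rewrite sumr_const -mulr_natl mulrA.
  apply: ler_sum => p pJ; rewrite (bigD1 p) //= mulrDr.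
  have -> : (K + 1) * N = 2 * N + (K - 1) * N by ring.
  apply: lerD.
    rewrite -(sum_h p pJ) mulrA; rewrite (eq_bigr (h p)) // => x _.
    by rewrite /h -natrM mulnb andbb.
  rewrite mulr_sumr; apply: (le_trans (y := \sum_(p' in J | p' != p) N)).
    by apply: ler_sum => p' /andP[p'J ne]; apply: sum_hh; rewrite // eq_sym.
  rewrite sumr_const -mulr_natl ler_wpM2r //.
  rewrite /K (cardsD1 p J) pJ natrD addrC addKr ler_nat.
  by apply/subset_leq_card/fintype.subsetP => q; rewrite !inE andbC.
have sum_E : 16 * D * \sum_(x in E) m x <= K * N.
  rewrite /m exchange_big mulr_sumr.
  have -> : K * N = \sum_(p in J) N by rewrite sumr_const -mulr_natl.
  apply: ler_sum => p pJ.
  have -> : \sum_(x in E) h p x = #|[set x in hplane p | f x != P p x]|%:R.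
    rewrite -sum_card big_mkcond; apply: eq_bigr => x _; rewrite /h !inE.
    have [xp|] := boolP (dot p.1 x == p.2); last by case: ifP.
    by rewrite (QP p x pJ) ?inE //; case: ifP.
  by rewrite -!natrM ler_nat ltnW // P_close.
have var : \sum_x (2 * m x - K) ^+ 2 <= K * N.
  have -> : \sum_x (2 * m x - K) ^+ 2 =
      4 * \sum_x m x ^+ 2 - 2 * K * (2 * \sum_x m x) + K ^+ 2 * N.
    have -> : K ^+ 2 * N = \sum_(x : point n) K ^+ 2.
      by rewrite sumr_const -mulr_natl card_point mulrC.
    by rewrite !mulr_sumr -sumrB -big_split; apply: eq_bigr => x _ /=; ring.
  by rewrite sum_m; lra.
(* 4 K m + (2 m - K)^2 = 4 m^2 + K^2 >= K^2 *)
have boundE : K ^+ 2 * #|E|%:R <= 4 * K * \sum_(x in E) m x + \sum_x (2 * m x - K) ^+ 2.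
  have -> : K ^+ 2 * #|E|%:R = \sum_(x in E) K ^+ 2.
    by rewrite sumr_const mulr_natr.
  apply: (@le_trans _ _ (\sum_(x in E) (4 * K * m x + (2 * m x - K) ^+ 2))).
    by apply: ler_sum => x _; have := sqr_ge0 (m x); lra.
  rewrite big_split /= -mulr_sumr lerD2l [leRHS](bigID (mem E)) /=.
  by rewrite lerDl sumr_ge0 // => x _; apply: sqr_ge0.
have D0 : 0 < D by rewrite ltr0n expn_gt0.
have KD : 4 * D < K.
  by rewrite -natrM ltr_nat -[4%N]/(2 ^ 2)%N -expnD addnC addn2.
rewrite -(ler_nat int) !natrM -/D -/N.
(* The sum is at most K N / (16 D), and N <= K N / (4 D) as K > 4 D, so each term contributes at
   most N / (4 D) to |E|. *)
have {}boundE : K * #|E|%:R <= 4 * \sum_(x in E) m x + N.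
  by rewrite -(ler_pM2l (x := K)); [lra | lra].
have N0 : 0 <= N by [].
rewrite -(ler_pM2l (x := 8 * K)); last lra.
have := ler_pM2l (x := 16 * D) _ (K * #|E|%:R) (4 * \sum_(x in E) m x + N).
rewrite boundE => H; have {H} : 16 * D * (K * #|E|%:R) <= 16 * D * (4 * \sum_(x in E) m x + N).
  by rewrite H //; lra.
have : 4 * D * N <= K * N by rewrite ler_wpM2r // ltW.
by lra.
Qed.

End Gluing.

(** * The tester *)

Lemma RM_comp d n p (A A' : point p -> point n) (f : bfun n) :
  (forall x e, A (x + e) = A x + A' e) ->
  f \in RM d n -> [ffun x => f (A x)] \in RM d p.
Proof.
move=> AD /RM_deglt df; apply/RM_deglt.
by apply: eq_deglt (deglt_comp AD df) => x; rewrite ffunE.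
Qed.

(** [g] stores the answers already read; the leaf applies [D] to the completed table. *)
Fixpoint tread n (s : seq (point n)) (g : bfun n) (D : pred (bfun n)) : dtree n :=
  if s is x :: s' then
    Query x (tread s' [ffun y => if y == x then 0 else g y] D)
            (tread s' [ffun y => if y == x then 1 else g y] D)
  else Output n (D g).

Lemma accepts_tread n s g D (f : bfun n) :
  accepts (tread s g D) f = D [ffun y => if y \in s then f y else g y].
Proof.
elim: s g => [|x s IHs] g /=.
  by congr (D _); apply/ffunP => y; rewrite ffunE.
have [fx|/F2_neq0 fx] := eqVneq (f x) 0; rewrite IHs; congr (D _);
  apply/ffunP => y; rewrite !ffunE in_cons;
  by have [->|] := eqVneq y x; rewrite ?fx ?if_same.
Qed.

Lemma nqueries_tread n s g D (f : bfun n) : nqueries (tread s g D) f = size s.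
Proof. by elim: s g => //= x s IHs g; rewrite !IHs if_same. Qed.

Fixpoint tpull n p (B : point p -> point n) (t : dtree p) : dtree n :=
  match t with
  | Output b => Output n b
  | Query x t0 t1 => Query (B x) (tpull B t0) (tpull B t1)
  end.

Lemma accepts_tpull n p (B : point p -> point n) t (f : bfun n) :
  accepts (tpull B t) f = accepts t [ffun y => f (B y)].
Proof. by elim: t => //= x t0 -> t1 ->; rewrite ffunE. Qed.

Lemma nqueries_tpull n p (B : point p -> point n) t (f : bfun n) :
  nqueries (tpull B t) f = nqueries t [ffun y => f (B y)].
Proof. by elim: t => //= x t0 -> t1 ->; rewrite ffunE. Qed.

Fixpoint tand n (t t' : dtree n) : dtree n :=
  match t with
  | Output b => if b then t' else Output n false
  | Query x t0 t1 => Query x (tand t0 t') (tand t1 t')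
  end.

Lemma accepts_tand n (t t' : dtree n) f :
  accepts (tand t t') f = accepts t f && accepts t' f.
Proof. by elim: t => [[]|x t0 IH0 t1 IH1] //=; case: ifP. Qed.

Lemma nqueries_tand n (t t' : dtree n) f :
  (nqueries (tand t t') f <= nqueries t f + nqueries t' f)%N.
Proof. by elim: t => [[]|x t0 IH0 t1 IH1] //=; rewrite addSn ltnS; case: ifP. Qed.

Section Testers.

Variable R : realType.

Lemma accept_reject n (T : ralg R n) f : accept_prob T f + reject_prob T f = 1.
Proof. by rewrite -(weight_sum1 T) [RHS](bigID (fun w : seed T => accepts (run w) f)). Qed.

Lemma accept_probE n (T : ralg R n) f :
  accept_prob T f = \sum_(w : seed T) weight w * (accepts (run w) f)%:R.
Proof.
rewrite /accept_prob big_mkcond; apply: eq_bigr => w _.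
by case: accepts; rewrite ?mulr1 ?mulr0.
Qed.

Lemma reject_probE n (T : ralg R n) f :
  reject_prob T f = \sum_(w : seed T) weight w * (~~ accepts (run w) f)%:R.
Proof.
rewrite /reject_prob big_mkcond; apply: eq_bigr => w _.
by case: accepts; rewrite ?mulr1 ?mulr0.
Qed.

Lemma reject_prob_ge0 n (T : ralg R n) f : 0 <= reject_prob T f.
Proof. by apply: sumr_ge0 => w _; apply: weight_ge0. Qed.

Lemma query_complexity_leP n (T : ralg R n) k :
  reflect (forall w f, nqueries (run (r := T) w) f <= k)%N
          (query_complexity T <= k)%N.
Proof.
rewrite /query_complexity; apply: (iffP (bigmax_leqP _ _ _)) => [H w f | H w _].
  by have /bigmax_leqP := H w isT; apply.
by apply/bigmax_leqP => f _; apply: H.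
Qed.

Lemma unit_sum1 : \sum_(w : unit) (1 : R) = 1.
Proof. by rewrite big_const card_unit /= addr0. Qed.

Definition det_alg n (t : dtree n) : ralg R n :=
  RAlg (fun _ => ler01) unit_sum1 (fun _ => t).

Lemma reject_det_alg n (t : dtree n) f :
  reject_prob (det_alg t) f = (~~ accepts t f)%:R.
Proof. by rewrite reject_probE /= big_const card_unit /= addr0 mul1r. Qed.

Lemma accept_det_alg n (t : dtree n) f :
  accept_prob (det_alg t) f = (accepts t f)%:R.
Proof. by rewrite accept_probE /= big_const card_unit /= addr0 mul1r. Qed.

Lemma card_hypS_gt0 n : 0 < #|hyp n.+1|%:R :> R.
Proof. by rewrite ltr0n card_hyp muln_gt0 subn_gt0 (ltn_exp2l 0). Qed.

(** Uniform choice of a hyperplane: seeds range over all pairs, and those with zero normal get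
    weight 0. *)
Definition hyp_weight n (T : ralg R n) (v : point n.+1 * 'F_2 * seed T) : R :=
  (v.1 \in hyp n.+1)%:R / #|hyp n.+1|%:R * weight v.2.

Lemma hyp_weight_ge0 n (T : ralg R n) v : 0 <= hyp_weight (T := T) v.
Proof. by apply: mulr_ge0; rewrite ?weight_ge0 // divr_ge0 // ler0n. Qed.

Lemma hyp_weight_sum1 n (T : ralg R n) : \sum_v hyp_weight (T := T) v = 1.
Proof.
rewrite -(pair_bigA _ (fun p w => hyp_weight (T := T) (p, w))) /hyp_weight /=.
under eq_bigr do rewrite -mulr_sumr weight_sum1 mulr1.
rewrite -mulr_suml -natr_sum -big_mkcond sum1_card divff //.
by rewrite gt_eqF ?card_hypS_gt0.
Qed.

Definition hyp_alg n (T : ralg R n) : ralg R n.+1 :=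
  RAlg (hyp_weight_ge0 (T := T)) (hyp_weight_sum1 T)
    (fun v => tpull (hpar v.1) (run v.2)).

Lemma reject_hyp_alg n (T : ralg R n) f :
  reject_prob (hyp_alg T) f =
  (\sum_(p in hyp n.+1) reject_prob T [ffun y => f (hpar p y)]) / #|hyp n.+1|%:R.
Proof.
rewrite reject_probE /=.
rewrite -(pair_bigA _ (fun p w => (p \in hyp n.+1)%:R / #|hyp n.+1|%:R * weight w *
   (~~ accepts (tpull (hpar p) (run w)) f)%:R)) /=.
rewrite mulr_suml [RHS]big_mkcond; apply: eq_bigr => p _.
case: ifP => _; last by rewrite big1 // => w _; rewrite !mul0r.
rewrite reject_probE mulr_suml; apply: eq_bigr => w _.
by rewrite accepts_tpull mul1r -mulrA mulrC.
Qed.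

Definition and_weight n (T T' : ralg R n) (v : seed T * seed T') : R :=
  weight v.1 * weight v.2.

Lemma and_weight_ge0 n (T T' : ralg R n) v : 0 <= and_weight (T := T) (T' := T') v.
Proof. by apply: mulr_ge0; apply: weight_ge0. Qed.

Lemma and_weight_sum1 n (T T' : ralg R n) :
  \sum_v and_weight (T := T) (T' := T') v = 1.
Proof.
rewrite -(pair_bigA _ (fun v w => and_weight (T := T) (T' := T') (v, w))) /and_weight /=.
under eq_bigr do rewrite -mulr_sumr weight_sum1 mulr1.
exact: weight_sum1.
Qed.

Definition and_alg n (T T' : ralg R n) : ralg R n :=
  RAlg (and_weight_ge0 (T := T) (T' := T')) (and_weight_sum1 T T')
    (fun v => tand (run v.1) (run v.2)).

Lemma accept_and_alg n (T T' : ralg R n) f :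
  accept_prob (and_alg T T') f = accept_prob T f * accept_prob T' f.
Proof.
rewrite !accept_probE /=.
rewrite -(pair_bigA _ (fun v w => weight v * weight w *
   (accepts (tand (run v) (run w)) f)%:R)) /=.
rewrite mulr_suml; apply: eq_bigr => v _; rewrite mulr_sumr.
by apply: eq_bigr => w _; rewrite accepts_tand -mulnb natrM mulrACA.
Qed.

Definition repeat_alg n m (T : ralg R n) : ralg R n :=
  iter m (and_alg T) (det_alg (Output n true)).

Lemma accept_repeat_alg n m (T : ralg R n) f :
  accept_prob (repeat_alg m T) f = accept_prob T f ^+ m.
Proof.
elim: m => [|m IHm]; first by rewrite accept_det_alg.
by rewrite /repeat_alg iterS accept_and_alg -/(repeat_alg _ _) IHm exprS.
Qed.

Lemma query_repeat_alg n m (T : ralg R n) k :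
  (query_complexity T <= k)%N -> (query_complexity (repeat_alg m T) <= m * k)%N.
Proof.
move=> /query_complexity_leP Tk; elim: m => [|m /query_complexity_leP IHm].
  exact/query_complexity_leP.
apply/query_complexity_leP => -[v w] f /=.
by apply: leq_trans (nqueries_tand _ _ _) _; rewrite mulSn leq_add.
Qed.

Definition read_alg d n : ralg R n :=
  det_alg (tread (enum {: point n}) [ffun=> 0] (fun g => g \in RM d n)).

Lemma reject_read_alg d n f : reject_prob (read_alg d n) f = (f \notin RM d n)%:R.
Proof.
rewrite reject_det_alg accepts_tread (_ : [ffun y => _] = f) //.
by apply/ffunP => y; rewrite ffunE mem_enum.
Qed.

(* Tests the degree of the restriction of f to a random affine subspace of
   dimension d + 3 (to the whole space if n <= d + 3). *)
Fixpoint rm_alg d n : ralg R n :=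
  if n is n'.+1 return ralg R n then
    if (n'.+1 <= d.+3)%N then read_alg d n'.+1 else hyp_alg (rm_alg d n')
  else read_alg d 0.

Lemma rm_alg_small d n : (n <= d.+3)%N -> rm_alg d n = read_alg d n.
Proof. by case: n => //= n ->. Qed.

Lemma rm_alg_large d n : (d.+3 <= n)%N -> rm_alg d n.+1 = hyp_alg (rm_alg d n).
Proof. by move=> dn; rewrite /= ltnNge dn. Qed.

Lemma query_rm_alg d n : (query_complexity (rm_alg d n) <= 2 ^ d.+3)%N.
Proof.
elim: n => [|n IHn]; last first.
  have [dn|nd] := leqP d.+3 n.
    rewrite rm_alg_large //; apply/query_complexity_leP => -[p w] f /=.
    by rewrite nqueries_tpull; have /query_complexity_leP -> := IHn.
  rewrite rm_alg_small //; apply/query_complexity_leP => w f /=.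
  by rewrite nqueries_tread -cardE card_point leq_exp2l.
rewrite rm_alg_small //; apply/query_complexity_leP => w f /=.
by rewrite nqueries_tread -cardE card_point leq_exp2l.
Qed.

Lemma reject_rm_alg_RM d n f : f \in RM d n -> reject_prob (rm_alg d n) f = 0.
Proof.
elim: n f => [|n IHn] f df; first by rewrite reject_read_alg df.
have [dn|nd] := leqP d.+3 n; last by rewrite rm_alg_small // reject_read_alg df.
rewrite rm_alg_large // reject_hyp_alg big1 ?mul0r // => p _.
by apply/IHn/(RM_comp (hparD p)).
Qed.

End Testers.

(** * Rejection probability *)

Definition ndiff n (f g : point n -> 'F_2) : nat := #|[set x | f x != g x]|.

Lemma ndiff_hpar n (f g : point n.+1 -> 'F_2) (p : point n.+1 * 'F_2) :
  p \in hyp n.+1 ->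
  ndiff (fun y => f (hpar p y)) (fun y => g (hpar p y)) =
  #|[set x | f x != g x] :&: hplane p|.
Proof.
move=> hp; rewrite /ndiff (card_hpar (fun x => f x != g x) hp).
by apply: eq_card => x; rewrite !inE andbC.
Qed.

Section RejectionProbability.

Variable R : realType.

Lemma sum_card_hplaneI n (E : {set point n}) :
  \sum_(p in hyp n) #|E :&: hplane p|%:R = #|E|%:R * (2 ^+ n - 1) :> R.
Proof.
have -> : 2 ^+ n - 1 = (2 ^ n - 1)%N%:R :> R by rewrite natrB ?expn_gt0 // natrX.
rewrite -natrM -natr_sum; congr _%:R.
under eq_bigr => p _ do rewrite -sum1dep_card big_mkcondr /=.
rewrite exchange_big -sum_nat_const; apply: eq_bigr => x _.
rewrite -big_mkcondr sum1dep_card -(card_hyp_through x).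
by apply: eq_card => p; rewrite !inE.
Qed.

(** Double counting of ordered pairs of distinct points of E: each pair lies on 2^n - 1 common
    hyperplanes. *)
Lemma sum_card_hplaneI2 n (E : {set point n.+1}) :
  \sum_(p in hyp n.+1) (#|E :&: hplane p|%:R * (#|E :&: hplane p|%:R - 1)) =
  #|E|%:R * (#|E|%:R - 1) * (2 ^+ n - 1) :> R.
Proof.
pose h (p : point n.+1 * 'F_2) (x : point n.+1) : R := (x \in hplane p)%:R.
have cardE p : #|E :&: hplane p|%:R = \sum_(x in E) h p x.
  rewrite -sum1_card natr_sum [LHS]big_mkcond [RHS]big_mkcond.
  apply: eq_bigr => x _; rewrite finset.in_setI /h.
  by case: (x \in E) => //=; case: (x \in hplane p).
have sum2 x y : \sum_(p in hyp n.+1) h p x * h p y =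
    2 ^+ n - 1 + (x == y)%:R * 2 ^+ n.
  have -> : \sum_(p in hyp n.+1) h p x * h p y =
      #|[set p in hyp n.+1 | (x \in hplane p) && (y \in hplane p)]|%:R.
    rewrite -sum1_card natr_sum [LHS]big_mkcond [RHS]big_mkcond.
    apply: eq_bigr => p _; rewrite [p \in [set _ | _]]inE /h -natrM mulnb.
    by case: (p \in hyp n.+1) => //=; case: (_ && _).
  have [<-|nexy] := eqVneq x y.
    have -> : [set p in hyp n.+1 | (x \in hplane p) && (x \in hplane p)] =
              [set p in hyp n.+1 | x \in hplane p].
      by apply/setP => p; rewrite !inE andbb.
    rewrite card_hyp_through natrB ?expn_gt0 // natrX exprS mul1r.
    by ring.
  rewrite mul0r addr0; have /eqP := card_hyp_through2 nexy.
  rewrite expnS eqn_mul2l /= => /eqP c.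
  by rewrite -natrX -c -natr1 addrK.
have -> : \sum_(p in hyp n.+1) (#|E :&: hplane p|%:R * (#|E :&: hplane p|%:R - 1)) =
   \sum_(p in hyp n.+1) #|E :&: hplane p|%:R ^+ 2 -
   \sum_(p in hyp n.+1) #|E :&: hplane p|%:R :> R.
  by rewrite -sumrB; apply: eq_bigr => p _; ring.
rewrite sum_card_hplaneI.
have -> : \sum_(p in hyp n.+1) #|E :&: hplane p|%:R ^+ 2 =
   \sum_(x in E) \sum_(y in E) \sum_(p in hyp n.+1) h p x * h p y :> R.
  under [RHS]eq_bigr => x _ do rewrite exchange_big.
  rewrite exchange_big; apply: eq_bigr => p _.
  rewrite cardE expr2 mulr_suml; apply: eq_bigr => x _.
  by rewrite mulr_sumr.
have -> : \sum_(x in E) \sum_(y in E) \sum_(p in hyp n.+1) h p x * h p y =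
    \sum_(x in E) (#|E|%:R * (2 ^+ n - 1) + 2 ^+ n).
  apply: eq_bigr => x xE; under eq_bigr do rewrite sum2.
  rewrite big_split /= sumr_const mulr_natl; congr (_ + _).
  rewrite (bigD1 x) //= eqxx mul1r big1 ?addr0 // => y /andP[_ ne].
  by rewrite eq_sym (negPf ne) mul0r.
by rewrite sumr_const -(mulr_natl _ #|E|) exprS; ring.
Qed.

(* With K = 2^(d+3) and M the number of points of a random (d+3)-dimensional
   affine subspace lying in a fixed set of m points of F_2^n, this is the
   expectation of M (8 - M) / 16. *)
Definition rej_bound d n (m : R) : R :=
  (7 * 2 ^+ d.+3 * m / 2 ^+ n -
   2 ^+ d.+3 * (2 ^+ d.+3 - 1) * (m * (m - 1)) / (2 ^+ n * (2 ^+ n - 1))) / 16.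

(** [rej_bound] combines the first two factorial moments of the intersection with a random subspace;
    averaging over hyperplanes carries each from dimension n to n + 1. *)
Lemma rej_bound_avg d n (E : {set point n.+1}) : (0 < n)%N ->
  (\sum_(p in hyp n.+1) rej_bound d n #|E :&: hplane p|%:R) / #|hyp n.+1|%:R =
  rej_bound d n.+1 #|E|%:R.
Proof.
move=> n0; rewrite /rej_bound -mulr_suml sumrB.
have -> (F : point n.+1 * 'F_2 -> R) c : \sum_(p in hyp n.+1) c * F p / 2 ^+ n =
   c * (\sum_(p in hyp n.+1) F p) / 2 ^+ n by rewrite mulr_sumr mulr_suml.
have -> (F : point n.+1 * 'F_2 -> R) c c' : \sum_(p in hyp n.+1) c * F p / c' =
   c * (\sum_(p in hyp n.+1) F p) / c' by rewrite mulr_sumr mulr_suml.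
rewrite sum_card_hplaneI sum_card_hplaneI2 card_hyp natrM natrB ?expn_gt0 // natrX.
have N1 : 1 < 2 ^+ n :> R by rewrite exprn_egt1 // ?ltr1n // -lt0n.
rewrite !(exprS 2 n); set K := 2 ^+ d.+3; set N := 2 ^+ n in N1 *; field.
by apply/and3P; split; apply/eqP; lra.
Qed.

Lemma reject_rm_alg_small d n (f : bfun n) : (n <= d.+3)%N ->
  reject_prob (rm_alg R d n) f = (f \notin RM d n)%:R.
Proof. by move=> nd; rewrite rm_alg_small // reject_read_alg. Qed.

(** Here the bound is M (8 - M) / 16, which never exceeds 1. It is at most 0 when f has degree at
    most d, because then f - g is zero or has weight at least 8. *)
Lemma rej_bound_base d (f g : bfun d.+3) : g \in RM d d.+3 ->
  rej_bound d d.+3 (ndiff f g)%:R <= reject_prob (rm_alg R d d.+3) f.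
Proof.
move=> dg; have -> : rej_bound d d.+3 (ndiff f g)%:R =
    (ndiff f g)%:R * (8 - (ndiff f g)%:R) / 16.
  have K1 : 1 < 2 ^+ d.+3 :> R by rewrite exprn_egt1 // ltr1n.
  rewrite /rej_bound; set K := 2 ^+ d.+3 in K1 *; set m := (ndiff f g)%:R; field.
  by apply/andP; split; apply/eqP; lra.
rewrite reject_rm_alg_small //; have [df|ndf] := boolP (f \in RM d d.+3); last first.
  by have := sqr_ge0 ((ndiff f g)%:R - 4 : R); rewrite /= mulr1n; lra.
have [m0|m_neq0] := eqVneq (ndiff f g) 0%N; first by rewrite m0 /=; lra.
have m8 : (8 <= ndiff f g)%N.
  have nz : exists x, f x - g x != 0.
    have /card_gt0P[x] : (0 < ndiff f g)%N by rewrite lt0n.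
    by rewrite inE => fgx; exists x; rewrite subr_eq0.
  move/RM_deglt: df => df; move/RM_deglt: dg => dg.
  have := deglt_min_wt (degltB df dg) nz.
  have -> : wt (fun x => f x - g x) = ndiff f g.
    by apply: eq_card => x; rewrite !inE subr_eq0.
  have -> : (2 * 2 ^ d.+3 = 2 ^ d.+1 * 8)%N by rewrite !expnS; lia.
  by rewrite leq_pmul2l // expn_gt0.
have : (8 : R) <= (ndiff f g)%:R by rewrite ler_nat.
rewrite /=; set m := (ndiff f g)%:R => m8R.
have : 0 <= m * (m - 8) by apply: mulr_ge0; lra.
by lra.
Qed.

(** Above dimension d + 3 both sides are averages over hyperplanes of their values one dimension
    lower. *)
Lemma rej_bound_le d n (f g : bfun n) : (d.+3 <= n)%N -> g \in RM d n ->
  rej_bound d n (ndiff f g)%:R <= reject_prob (rm_alg R d n) f.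
Proof.
elim: n f g => // n IHn f g ltdn dg; have [dn|nd] := leqP d.+3 n; last first.
  have nE : n = d.+2 by apply/eqP; rewrite eqn_leq -ltnS nd -ltnS ltdn.
  by subst n; apply: rej_bound_base.
have n0 : (0 < n)%N by apply: leq_trans dn.
rewrite rm_alg_large // reject_hyp_alg /ndiff -rej_bound_avg //.
rewrite ler_wpM2r ?invr_ge0 ?ler0n //; apply: ler_sum => p hp.
have := IHn [ffun y => f (hpar p y)] _ dn (RM_comp (hparD p) dg).
have -> : ndiff [ffun y => f (hpar p y)] [ffun y => g (hpar p y)] =
          ndiff (fun y => f (hpar p y)) (fun y => g (hpar p y)).
  by apply: eq_card => y; rewrite !inE !ffunE.
by rewrite ndiff_hpar.
Qed.

Lemma reject_near d n (f g : bfun n) : (d.+3 <= n)%N -> g \in RM d n ->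
  (2 * 2 ^ d * ndiff f g <= 2 ^ n)%N ->
  2 ^+ d * (ndiff f g)%:R / 2 ^+ n <= reject_prob (rm_alg R d n) f.
Proof.
move=> dn dg near; apply: le_trans (rej_bound_le _ dn dg).
have N1 : 1 < 2 ^+ n :> R by rewrite exprn_egt1 // ?ltr1n // -lt0n (leq_trans _ dn).
have D1 : 1 <= 2 ^+ d :> R by rewrite exprn_ege1 // ler1n.
have mN : (ndiff f g)%:R <= 2 ^+ n :> R.
  by rewrite -natrX ler_nat -card_point max_card.
have {}near : 2 * 2 ^+ d * (ndiff f g)%:R <= 2 ^+ n :> R.
  by rewrite -!natrX -!natrM ler_nat.
rewrite /rej_bound !exprS; move: near mN (ler0n R (ndiff f g)).
set N := 2 ^+ n in N1 *; set D := 2 ^+ d in D1 *; set m := (ndiff f g)%:R => near mN m0.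
have N0 : 0 < N by lra.
(* x is 2^d times the distance of f and g, at most 1/2; the bound is at least (56 x - 64 x^2) / 16,
   which is at least x. *)
pose x := D * m / N.
have x0 : 0 <= x by rewrite /x !mulr_ge0 ?invr_ge0 //; lra.
have x_half : 2 * x <= 1 by rewrite /x mulrA ler_pdivrMr //; lra.
have pairs : 2 * (2 * (2 * D)) * (2 * (2 * (2 * D)) - 1) * (m * (m - 1)) / (N * (N - 1))
    <= 64 * x ^+ 2.
  rewrite ler_pdivrMr; last by rewrite mulr_gt0 //; lra.
  have -> : 64 * x ^+ 2 * (N * (N - 1)) = 64 * D ^+ 2 * (m ^+ 2 * (N - 1) / N).
    by rewrite /x; field; apply/eqP; lra.
  have H1 : m * (m - 1) <= m ^+ 2 * (N - 1) / N.
    by rewrite ler_pdivlMr //; have := mulr_ge0 m0 (_ : 0 <= N - m); rewrite subr_ge0 mN => /(_ isT); lra.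
  have H2 : 0 <= m ^+ 2 * (N - 1) / N.
    by rewrite !mulr_ge0 ?invr_ge0 ?sqr_ge0 //; lra.
  have -> : 2 * (2 * (2 * D)) * (2 * (2 * (2 * D)) - 1) = 64 * D ^+ 2 - 8 * D by ring.
  apply: le_trans (_ : (64 * D ^+ 2 - 8 * D) * (m ^+ 2 * (N - 1) / N) <= _).
    by rewrite ler_wpM2l // ; nra.
  by rewrite ler_wpM2r //; lra.
have -> : 7 * (2 * (2 * (2 * D))) * m / N = 56 * x by rewrite /x; field; apply/eqP; lra.
have : x * (2 * x) <= x by rewrite ler_piMr.
by rewrite -/x; lra.
Qed.

Definition near_on d n (f : bfun n.+1) (p : point n.+1 * 'F_2) : bool :=
  [exists g in RM d n, 8 * 2 ^ d * ndiff (fun y => f (hpar p y)) g < 2 ^ n]%N.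

(** With more hyperplanes, the close polynomials on them would glue to a polynomial of degree at
    most d on the whole space that contradicts [far]. *)
Lemma card_near_on d n (f : bfun n.+1) :
  (forall g, g \in RM d n.+1 -> 2 ^ n.+1 < 2 * 2 ^ d * ndiff f g)%N ->
  (#|[set p in hyp n.+1 | near_on d f p]| <= 2 ^ d.+2)%N.
Proof.
move=> far; rewrite leqNgt; apply/negP; set J := [set p in _ | _] => J_large.
(* On J the default 0 is never taken. *)
pose g p : bfun n := odflt [ffun=> 0] [pick g in RM d n |
  8 * 2 ^ d * ndiff (fun y => f (hpar p y)) g < 2 ^ n]%N.
have gP p : p \in J -> g p \in RM d n /\
    (8 * 2 ^ d * ndiff (fun y => f (hpar p y)) (g p) < 2 ^ n)%N.
  rewrite inE => /andP[_ /exists_inP[g0 dg0 fg0]]; rewrite /g.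
  by case: pickP => [g1 /andP[] //|/(_ g0)]; rewrite dg0 fg0.
pose P p x := g p (hproj p x).
have J_hyp : J \subset hyp n.+1.
  by apply/fintype.subsetP => p; rewrite inE => /andP[].
have dP p : p \in J -> deglt d.+1 (P p).
  by move=> /gP[/RM_deglt dg _]; apply: (deglt_comp (hprojD p) dg).
have close p : p \in J ->
    (16 * 2 ^ d * #|[set x in hplane p | f x != P p x]| < 2 ^ n.+1)%N.
  move=> pJ; have hp := fintype.subsetP J_hyp p pJ.
  have [_] := gP p pJ; rewrite -(card_hpar (fun x => f x != P p x) hp) expnS.
  have -> : #|[set y | f (hpar p y) != P p (hpar p y)]| =
            ndiff (fun y => f (hpar p y)) (g p).
    by apply: eq_card => y; rewrite !inE /P hparK.
  by set D := (2 ^ d)%N; nia.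
have [Q dQ QP] := glue J_large dP close.
have closeQ := card_disagree_hplanes J_large close J_hyp QP.
have dQ' : [ffun x => Q x] \in RM d n.+1.
  by apply/RM_deglt; apply: eq_deglt dQ => x; rewrite ffunE.
have := far _ dQ'; rewrite ltnNge => /negP; apply.
rewrite /ndiff (_ : [set x | _] = [set x | f x != Q x]) //.
by apply/setP => x; rewrite !inE ffunE.
Qed.

(** The summand 8 * 2^d / 2^n closes the induction: it halves when n grows by one, and this slack
    pays for the hyperplanes where f may be close to the code. *)
Lemma reject_far d n (f : bfun n) : (d.+3 <= n)%N ->
  (forall g, g \in RM d n -> 2 ^ n <= 8 * 2 ^ d * ndiff f g)%N ->
  (1 + 8 * 2 ^+ d / 2 ^+ n) / 16 <= reject_prob (rm_alg R d n) f.
Proof.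
elim: n f => // n IHn f ltdn far; have D0 : 0 < 2 ^+ d :> R by rewrite exprn_gt0.
have N0 : 0 < 2 ^+ n.+1 :> R by rewrite exprn_gt0.
have dN : 8 * 2 ^+ d <= 2 ^+ n.+1 :> R.
  by rewrite -!natrX -natrM ler_nat -[8%N]/(2 ^ 3)%N -expnD leq_exp2l.
have eps_le : 8 * 2 ^+ d / 2 ^+ n.+1 <= 1 :> R by rewrite ler_pdivrMr ?mul1r.
have [dn|nd] := leqP d.+3 n; last first.
  rewrite reject_rm_alg_small // (_ : _ \notin _) /=; first by lra.
  apply/negP => /far; rewrite leqNgt (_ : ndiff f f = 0%N) ?muln0 ?expn_gt0 //.
  by apply: eq_card0 => x; rewrite !inE eqxx.
(* At distance between 2^-(d+3) and 2^-(d+1), [reject_near] gives at least 1/8, while the claimed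
   bound is at most 2/16. *)
have [/exists_inP[g dg near]|/exists_inPn nfar] :=
    boolP [exists g in RM d n.+1, 2 * 2 ^ d * ndiff f g <= 2 ^ n.+1]%N.
  apply: le_trans (reject_near ltdn dg near).
  have : 1 <= 8 * (2 ^+ d * (ndiff f g)%:R / 2 ^+ n.+1) :> R.
    by rewrite !mulrA ler_pdivlMr // mul1r -!natrX -!natrM ler_nat far.
  by lra.
have nfar' g : g \in RM d n.+1 -> (2 ^ n.+1 < 2 * 2 ^ d * ndiff f g)%N.
  by move=> /nfar; rewrite -ltnNge.
have cardJ := card_near_on nfar'; set J := [set p in _ | _] in cardJ.
rewrite rm_alg_large // reject_hyp_alg ler_pdivlMr ?card_hypS_gt0 //.
set e := (1 + 8 * 2 ^+ d / 2 ^+ n) / 16 in IHn.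
have e0 : 0 <= e by rewrite divr_ge0 // addr_ge0 // divr_ge0 // ?mulr_ge0 // ltW // exprn_gt0.
(* All but at most 2^(d+2) hyperplanes satisfy the induction hypothesis. *)
apply: le_trans (_ : (#|hyp n.+1|%:R - 4 * 2 ^+ d) * e <= _); last first.
  apply: le_trans (_ : \sum_(p in hyp n.+1 :\: J) e <= _).
    rewrite sumr_const -(mulr_natl e) ler_wpM2r //.
    rewrite cardsD (finset.setIidPr _); last by apply/fintype.subsetP => p; rewrite inE => /andP[].
    rewrite natrB; last by apply/subset_leq_card/fintype.subsetP => p; rewrite inE => /andP[].
    by rewrite lerD2l lerN2 -natrX -natrM ler_nat -[4%N]/(2 ^ 2)%N -expnD.
  rewrite [leRHS](big_setID J) /= -[leLHS]add0r lerD //.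
    by apply: sumr_ge0 => p _; apply: reject_prob_ge0.
  apply: ler_sum => p; rewrite !inE => /andP[npJ hp]; apply: IHn => // g dg.
  move: npJ; rewrite hp /= => /exists_inPn /(_ g dg); rewrite -leqNgt.
  have -> // : ndiff (fun y => f (hpar p y)) g = ndiff [ffun y => f (hpar p y)] g.
  by apply: eq_card => y; rewrite !inE ffunE.
have dN' : 8 * 2 ^+ d <= 2 ^+ n :> R.
  by rewrite -!natrX -natrM ler_nat -[8%N]/(2 ^ 3)%N -expnD leq_exp2l.
rewrite card_hyp natrM natrB ?expn_gt0 // natrX /e exprS; move: D0 dN'.
set N := 2 ^+ n; set D := 2 ^+ d => D0 dN'.
have {}N0 : 0 < N by lra.
have N1 : 1 <= N by rewrite exprn_ege1 // ler1n.
pose s := D / N; have Ds : D = s * N by rewrite /s divfK //; apply/eqP; lra.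
have s0 : 0 < s by rewrite divr_gt0.
have s8 : 8 * s <= 1 by rewrite /s mulrA ler_pdivrMr // mul1r.
have -> : 8 * D / N = 8 * s by rewrite /s mulrA.
have -> : 8 * D / (2 * N) = 4 * s by rewrite /s; field; apply/eqP; lra.
(* Up to the factor 16, the two sides differ by 4 s (4 N - 2 - N (1 + 8 s)), nonnegative since 8 s
   <= 1 <= N. *)
rewrite Ds; nra.
Qed.

End RejectionProbability.

(** * The one-sided tester *)

Lemma distE (R : realType) n (f g : bfun n) :
  dist R f g = (ndiff f g)%:R / 2 ^+ n.
Proof. by rewrite /dist card_point natrX. Qed.

(** The assumption r <= 1 covers the default value 1 of the minimum. *)
Lemma dist_to_ge (R : realType) n (f : bfun n) (G : {set bfun n}) (r : R) : r <= 1 ->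
  reflect (forall g, g \in G -> r <= dist R f g) (r <= dist_to R f G).
Proof.
move=> r1; rewrite /dist_to; apply: (iffP (bigmin_geP _ _ _ _)) => [[]|] //.
Qed.

Lemma RM_affine_invariant d : affine_invariant (fun n => RM (d n) n).
Proof.
move=> n _ f A df [M [b AE]]; apply: (RM_comp (A' := fun e => e *m M)) df.
by move=> x e; rewrite !AE mulmxDl addrAC.
Qed.

(** For n <= d + 3 all of f is read; near the code the bound is 2^d times the distance; elsewhere it
    is 1/16. As delta / 16 depends on neither d nor n, a fixed number of repetitions will
    suffice. *)
Lemma reject_ge_dist (R : realType) d n (f : bfun n) (delta : R) :
  0 < delta <= 1 -> delta <= dist_to R f (RM d n) ->
  delta / 16 <= reject_prob (rm_alg R d n) f.
Proof.
case/andP=> delta0 delta1 /(dist_to_ge _ _ delta1) far.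
have [nd|dn] := leqP n d.+3.
  rewrite reject_rm_alg_small // (_ : _ \notin _); first by rewrite mulr1n; lra.
  apply/negP => /far; rewrite distE (_ : ndiff f f = 0%N) ?mul0r; first by lra.
  by apply: eq_card0 => x; rewrite !inE eqxx.
have dn' := ltnW dn.
have [/exists_inP[g dg near]|/exists_inPn nfar] :=
    boolP [exists g in RM d n, 2 * 2 ^ d * ndiff f g <= 2 ^ n]%N.
  apply: le_trans (reject_near R dn' dg near).
  have := far g dg; rewrite distE => fg.
  apply: (@le_trans _ _ ((ndiff f g)%:R / 2 ^+ n)); first by lra.
  rewrite -mulrA ler_peMl ?exprn_ege1 ?ler1n //; lra.
apply: le_trans (reject_far R dn' _).
  have : 0 <= 8 * 2 ^+ d / 2 ^+ n :> R by rewrite !mulr_ge0 ?invr_ge0 ?exprn_ge0.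
  by lra.
move=> g /nfar; rewrite -ltnNge => /ltnW /leq_trans; apply.
by rewrite !leq_mul2r /= !orbT.
Qed.

(** Bernoulli: (1 - e)^m (1 + m e) <= 1, and m > 2 / e makes the second factor exceed 3. *)
Lemma exists_expr_le (R : realType) (e : R) : 0 < e <= 1 ->
  exists m : nat, (1 - e) ^+ m <= 1 / 3.
Proof.
case/andP=> e0 e1.
have bernoulli m : (1 - e) ^+ m * (1 + m%:R * e) <= 1.
  elim: m => [|m IHm]; first by rewrite expr0 mul0r addr0 mulr1.
  apply: le_trans IHm; rewrite exprSr -mulrA ler_wpM2l ?exprn_ge0 ?subr_ge0 //.
  by have := ler0n R m; rewrite -natr1; nra.
have [m] : exists m : nat, 2 / e < m%:R.
  by exists (Num.truncn (2 / e)).+1; apply: Num.Theory.truncnS_gt.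
rewrite ltr_pdivrMr // => me; exists m.
have p0 : 0 <= (1 - e) ^+ m by rewrite exprn_ge0 ?subr_ge0.
by have := bernoulli m; nra.
Qed.

Lemma expn_up_log_le m : (0 < m)%N -> (2 ^ up_log 2 m <= 2 * m)%N.
Proof.
case: m => [//|[|m]] _; first by rewrite up_log1.
have /andP[lo _] := @up_log_bounds 2 m.+2 isT isT.
have : (0 < up_log 2 m.+2)%N by rewrite up_log_gt0.
by case: (up_log 2 m.+2) lo => //= k lo _; rewrite expnS leq_mul2l /= ltnW.
Qed.

Lemma RM_one_sided_testable (R : realType) (q : nat -> nat) :
  (forall n : nat, (0 < n)%N -> (0 < q n)%N) ->
  one_sided_testable_O R (fun n => RM (up_log 2 (q n)) n) q.
Proof.
move=> q0 delta delta01; case/andP: (delta01) => delta0 delta1.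
have [|m small] := @exists_expr_le R (delta / 16); first by lra.
(* The factor 16 arises since a run makes at most 2^(d+3) queries and 2^d <= 2 q n. *)
exists (fun n => repeat_alg m (rm_alg R (up_log 2 (q n)) n)), (m * 16)%N.
have one n f : f \in RM (up_log 2 (q n)) n ->
    accept_prob (repeat_alg m (rm_alg R (up_log 2 (q n)) n)) f = 1.
  move=> df; rewrite accept_repeat_alg.
  have := accept_reject (rm_alg R (up_log 2 (q n)) n) f.
  by rewrite reject_rm_alg_RM // addr0 => ->; rewrite expr1n.
split=> [n n0 f|n _ f|n n0]; last 2 first.
- exact: one.
- apply: leq_trans (query_repeat_alg m (query_rm_alg R _ _)) _.
  rewrite -mulnA leq_mul2l !expnS; apply/orP; right.
  by have := expn_up_log_le (q0 n n0); lia.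
split=> [/one -> | far]; first by lra.
have := accept_reject (repeat_alg m (rm_alg R (up_log 2 (q n)) n)) f.
rewrite accept_repeat_alg; have := reject_ge_dist delta01 far.
have := accept_reject (rm_alg R (up_log 2 (q n)) n) f.
set a := accept_prob _ f; set r := reject_prob _ f; set r' := reject_prob _ f.
move=> ar rd ar'; have a0 : 0 <= a by apply: sumr_ge0 => w _; apply: weight_ge0.
have : a ^+ m <= (1 - delta / 16) ^+ m.
  by rewrite lerXn2r ?nnegrE //; lra.
by lra.
Qed.

(** * Lower bound *)

(** A coordinate separating two points splits Q. The larger side is interpolated by induction on
    cardinality; the error on the other, at most half of Q, is fixed by a polynomial of degree one
    less times the affine indicator of that side. *)
Lemma interpolation n d (Q : {set point n}) (f : point n -> 'F_2) :
  (#|Q| <= 2 ^ d)%N ->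
  exists2 h, deglt d.+1 h & forall x, x \in Q -> h x = f x.
Proof.
have small k (W : {set point n}) (u : point n -> 'F_2) : (#|W| <= 1)%N ->
    exists2 h, deglt k.+1 h & forall x, x \in W -> h x = u x.
  move=> W1; have [->|[x xW]] := finset.set_0Vmem W.
    by exists (fun _ => 0) => [|x]; [exact: deglt_zero | rewrite inE].
  exists (fun _ => u x) => [|y yW]; last by rewrite (card_le1_eqP W1 x y xW yW).
  by apply: (@deglt_leq _ 1) => //; exact: deglt_const.
elim: d Q f => [|d IHd] Q f; first exact: small.
have [k ltk] := ubnP #|Q|; elim: k => // k IHk in Q f ltk *.
move=> cQ; have [Q1|/card_gt1P[x [y [xQ yQ nexy]]]] := leqP #|Q| 1; first exact: small.
have /existsP[i nei] : [exists i, x 0 i != y 0 i].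
  by apply: contraNT nexy => /existsPn z; apply/eqP/rowP => i; apply/eqP/negPn/z.
pose side (b : 'F_2) := [set z in Q | z 0 i == b].
have [a [aQ ca]] : exists a, a \in Q /\ (2 * #|side (a 0%R i)| <= #|Q|)%N.
  have : (#|side (x 0%R i)| + #|side (y 0%R i)| <= #|Q|)%N.
    rewrite -cardsUI (_ : _ :&: _ = finset.set0) ?cards0 ?addn0; last first.
      apply/setP => z; rewrite !inE; apply: contraNF nei.
      by case/andP=> /andP[_ /eqP <-] /andP[_ /eqP <-].
    by apply/subset_leq_card/fintype.subsetP => z; rewrite !inE -andb_orr => /andP[].
  by have [h|h] := leqP #|side (x 0 i)| #|side (y 0 i)|; [exists x | exists y]; lia.
have [||h0 dh0 h0f] := IHk (Q :\: side (a 0 i)) f.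
- rewrite -ltnS; apply: leq_trans ltk; rewrite ltnS; apply: proper_card.
  apply/properP; split; first exact: finset.subsetDl.
  by exists a => //; rewrite !inE aQ eqxx.
- by apply: leq_trans cQ; apply: subset_leq_card; exact: finset.subsetDl.
have [|h1 dh1 h1f] := IHd (side (a 0 i)) (fun z => f z - h0 z).
  by move: cQ; rewrite expnS; lia.
have LD (z e : point n) : (z + e) 0 i - a 0 i + 1 = z 0 i - a 0 i + 1 + e 0 i.
  by rewrite mxE; ring.
exists (fun z => h0 z + (z 0 i - a 0 i + 1) * h1 z).
  exact: degltD dh0 (deglt_mul_affine LD dh1).
move=> z zQ; have [za|nza] := eqVneq (z 0 i) (a 0 i).
  by rewrite za subrr add0r mul1r h1f ?inE ?zQ ?za //= addrC subrK.
rewrite (F2_neq0 (c := z 0 i - a 0 i)) ?subr_eq0 // F2_addxx mul0r addr0.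
by apply: h0f; rewrite !inE zQ (negPf nza).
Qed.

(** * Indistinguishability of the code from its translates *)

Definition satisfies n (c : seq (point n * 'F_2)) (f : bfun n) : bool :=
  all (fun p => f p.1 == p.2) c.

Lemma card_accepts_Query n (G : {set bfun n}) (phi : bfun n -> bfun n) c x t0 t1 :
  #|[set g in G | satisfies c (phi g) && accepts (Query x t0 t1) (phi g)]| =
  (#|[set g in G | satisfies ((x, 0%R) :: c) (phi g) && accepts t0 (phi g)]| +
   #|[set g in G | satisfies ((x, 1%R) :: c) (phi g) && accepts t1 (phi g)]|)%N.
Proof.
rewrite -(cardsID [set g | phi g x == 0]); congr (_ + _)%N; apply: eq_card => g;
  rewrite !inE /=; have [fx|/F2_neq0 fx] := eqVneq (phi g x) 0;
  by rewrite ?fx ?eqxx ?oner_eq0 ?(eq_sym 0 1) ?oner_eq0 /= ?andbT ?andbF.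
Qed.

(* RM d n is 2^d-wise independent, hence indistinguishable from any of its
   translates. *)
Lemma card_accepts_translate n d (f0 : bfun n) (t : dtree n) c :
  (forall f, satisfies c f -> size c + nqueries t f <= 2 ^ d)%N ->
  #|[set g in RM d n | satisfies c g && accepts t g]| =
  #|[set g in RM d n | satisfies c (f0 + g) && accepts t (f0 + g)]|.
Proof.
elim: t c => [b|x t0 IH0 t1 IH1] c bound; last first.
  rewrite (card_accepts_Query _ id) (card_accepts_Query _ (fun g => f0 + g)).
  by congr (_ + _)%N; [apply: IH0 | apply: IH1] => f /= /andP[/eqP fx /bound /=];
     rewrite fx ?eqxx ?oner_eq0 addnS addSn.
have [[f cf]|none] := pselect (exists f, satisfies c f); last first.
  by rewrite !eq_card0 // => g; rewrite !inE; apply/negP => /and3P[_ cg _];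
     apply: none; eexists; exact: cg.
(* At a leaf, h agrees with f0 on all queried points, so u -> u + h sends the codewords u with f0 +
   u consistent with [c] bijectively to the codewords consistent with [c]. *)
have [|h dh hf] := @interpolation n d [set x in map fst c] f0.
  apply: leq_trans (bound f cf) => /=; rewrite addn0 -(size_map fst c).
  by rewrite cardsE; apply: card_size.
pose h' : bfun n := [ffun x => h x].
have dh' : deglt d.+1 h' by apply: eq_deglt dh => x; rewrite ffunE.
rewrite -[RHS](card_imset _ (addIr (h' : bfun n))); apply: eq_card => g.
have cE u : satisfies c (f0 + u) = satisfies c (u + h').
  apply: eq_in_all => p pc; rewrite !ffunE hf ?[f0 _ + _]addrC //.
  by rewrite inE; apply: map_f.
rewrite [LHS]inE; apply/idP/imsetP => [/and3P[/RM_deglt dg cg gb]|].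
  exists (g - h'); last by rewrite subrK.
  rewrite inE cE subrK cg [accepts _ _]gb !andbT; apply/RM_deglt.
  by apply: eq_deglt (degltB dg dh') => x; rewrite !ffunE.
case=> u; rewrite inE cE => /and3P[/RM_deglt du cu ub] ->.
rewrite cu [accepts _ _]ub !andbT; apply/RM_deglt.
by apply: eq_deglt (degltD du dh') => x; rewrite !ffunE.
Qed.

Lemma sum_accept_translate (R : realType) n d (f0 : bfun n) (T : ralg R n) :
  (query_complexity T <= 2 ^ d)%N ->
  \sum_(g in RM d n) accept_prob T g = \sum_(g in RM d n) accept_prob T (f0 + g).
Proof.
move/query_complexity_leP => Td.
have swap (phi : bfun n -> bfun n) : \sum_(g in RM d n) accept_prob T (phi g) =
    \sum_(w : seed T) weight w *
      #|[set g in RM d n | satisfies [::] (phi g) && accepts (run w) (phi g)]|%:R.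
  under eq_bigr do rewrite accept_probE.
  rewrite exchange_big; apply: eq_bigr => w _; rewrite -mulr_sumr; congr (_ * _).
  rewrite -sum1_card natr_sum [LHS]big_mkcond [RHS]big_mkcond.
  apply: eq_bigr => g _; rewrite [in RHS]inE /=.
  by case: (g \in RM d n) => //=; case: accepts.
rewrite (swap id) (swap (fun g => f0 + g)); apply: eq_bigr => w _.
by congr (_ * _%:R); apply: card_accepts_translate => f _; apply: Td.
Qed.

(** * Existence of a function far from the code *)

(** Complementation sends sets of size at most d to sets of size more than d. *)
Lemma card_small_sets n d : (2 * d < n)%N ->
  (2 * #|[set S : {set 'I_n} | #|S| <= d]| <= 2 ^ n)%N.
Proof.
move=> dn; set D := [set S : {set 'I_n} | _].
have -> : (2 ^ n = #|{: {set 'I_n}}|)%N by rewrite -cardsT -powersetT card_powerset cardsT card_ord.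
rewrite mul2n -addnn -{2}(card_imset D (inv_inj (@finset.setCK _))) -cardsUI.
rewrite (_ : _ :&: _ = finset.set0) ?cards0 ?addn0 ?max_card //.
apply/setP => S; rewrite !inE; apply/negP => /andP[Sd /imsetP[S']].
rewrite inE => S'd SE; have := cardsC S'; rewrite -SE card_ord; lia.
Qed.

Lemma card_RM n d : (2 * d < n)%N -> (#|RM d n| ^ 2 <= 2 ^ 2 ^ n)%N.
Proof.
move=> dn; set D := [set S : {set 'I_n} | #|S| <= d]%N.
have : (#|RM d n| <= 2 ^ #|D|)%N.
  have <- : #|pffun_on (0 : 'F_2) (mem D) predT| = (2 ^ #|D|)%N.
    by rewrite card_pffun_on (card_Fp (p := 2)).
  rewrite -(card_imset _ (can_inj (@mlrepK n))); apply: subset_leq_card.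
  apply/fintype.subsetP => _ /imsetP[f df ->]; apply/pffun_onP; split=> //.
  apply/supportP => S; rewrite inE -ltnNge => dS.
  by apply: (deglt_coef (k := d.+1)) dS; rewrite mlrepK; apply/RM_deglt.
rewrite -(@leq_exp2r _ _ 2) // => /leq_trans; apply.
by rewrite -expnM leq_exp2l // mulnC card_small_sets.
Qed.

(** Chernoff-type count: giving h the weight 8 to the number of its zeros makes the total 9^N, while
    each h in the ball has weight at least 8^(N - w). *)
Lemma card_ball n : (0 < #|[set h : bfun n | 16 * wt h < 2 ^ n]|)%N /\
  (#|[set h : bfun n | 16 * wt h < 2 ^ n]| ^ 4 < 2 ^ (2 * 2 ^ n))%N.
Proof.
set V := [set _ | _]; set N := (2 ^ n)%N in V *.
have N0 : (0 < N)%N by rewrite expn_gt0.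
split.
  apply/card_gt0P; exists 0; rewrite inE (_ : wt _ = 0%N) ?muln0 //.
  by apply: eq_card0 => x; rewrite !inE ffunE eqxx.
pose w := (N.-1 %/ 16)%N.
have wN : (16 * w < N)%N by rewrite mulnC -[ltnRHS](prednK N0) ltnS leq_divM.
have Vw h : h \in V -> (wt h <= w)%N by rewrite inE -[ltnRHS](prednK N0) ltnS /w leq_divRL // mulnC.
have total : (\sum_(h : bfun n) 8 ^ (N - wt h) = 9 ^ N)%N.
  have -> : (9 ^ N = \prod_(x : point n) \sum_(v : 'F_2) (if v == 0%R then 8 else 1))%N.
    rewrite prod_nat_const card_point (bigD1 0) //= (eq_bigr (fun=> 1%N)).
      by rewrite sum1_card cardC1 (card_Fp (p := 2)).
    by move=> v /negPf ->.
  rewrite bigA_distr_bigA; apply: eq_bigr => h _.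
  rewrite -big_mkcond prod_nat_const; congr (8 ^ _)%N.
  have := cardC [pred x | h x == 0]; rewrite card_point -/N.
  have -> : #|[predC [pred x | h x == 0]]| = wt h.
    by apply: eq_card => x; rewrite !inE.
  by move=> <-; rewrite addnK.
have V4 : (#|V| * 8 ^ (N - w) <= 9 ^ N)%N.
  rewrite -total -sum_nat_const [leqRHS](bigID (mem V)) /=.
  apply: leq_trans (leq_addr _ _); apply: leq_sum => h /Vw hw.
  by rewrite leq_exp2l // leq_sub2l.
have p8 : (0 < 8 ^ (4 * N))%N by rewrite expn_gt0.
rewrite -(ltn_pmul2r p8).
(* The constants fit because 2 * 9^4 = 13122 < 16384 = 2^2 * 8^4; the factor 2 absorbs 8^(4 w) <=
   2^N. *)
apply: (@leq_ltn_trans ((9 ^ 4 * 2) ^ N)).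
  have -> : (4 * N = (N - w) * 4 + 4 * w)%N by lia.
  rewrite expnD mulnA expnM -expnMn [leqRHS]expnMn leq_mul //.
    by rewrite -[leqRHS]expnM [(4 * N)%N]mulnC [leqRHS]expnM leq_exp2r.
  by rewrite -[8%N]/(2 ^ 3)%N -expnM leq_exp2l //; lia.
apply: (@leq_trans ((2 ^ 2 * 8 ^ 4) ^ N)); first by rewrite ltn_exp2r.
by rewrite expnMn -!expnM.
Qed.

(** Otherwise sums of a codeword and a ball element give all functions, but the fourth power of the
    number of such pairs is below 2^(4 * 2^n). *)
Lemma exists_far n d : (2 * d < n)%N ->
  exists f0 : bfun n, forall g, g \in RM d n -> (2 ^ n <= 16 * ndiff f0 g)%N.
Proof.
move=> dn; apply/not_existsP => none.
have [V0 V4] := card_ball n; set V := [set _ | _] in V0 V4.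
have cover : (2 ^ 2 ^ n <= #|RM d n| * #|V|)%N.
  have <- : #|{: bfun n}| = (2 ^ 2 ^ n)%N by rewrite card_ffun card_point (card_Fp (p := 2)).
  rewrite -cardsX -cardsT.
  apply: leq_trans (leq_imset_card (fun p : bfun n * bfun n => p.1 + p.2) _).
  apply/subset_leq_card/fintype.subsetP => f _.
  have /existsNP[g /not_implyP[dg /negP]] := none f; rewrite -ltnNge => fg.
  apply/imsetP; exists (g, f - g); last by rewrite /= addrC subrK.
  rewrite !inE /=; move: dg; rewrite inE => -> /=.
  rewrite (_ : wt _ = ndiff f g) //; apply: eq_card => x.
  by rewrite !inE !ffunE subr_eq0.
have R2 := card_RM dn.
have : (2 ^ (4 * 2 ^ n) <= #|RM d n| ^ 4 * #|V| ^ 4)%N.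
  by rewrite -expnMn mulnC expnM leq_exp2r.
rewrite leqNgt => /negP; apply.
have R4 : (#|RM d n| ^ 4 <= 2 ^ (2 * 2 ^ n))%N.
  by rewrite (expnM _ 2 2) [(2 * _)%N]mulnC expnM leq_exp2r.
apply: (@leq_ltn_trans (2 ^ (2 * 2 ^ n) * #|V| ^ 4)).
  by rewrite leq_mul2r R4 orbT.
have -> : (4 * 2 ^ n = 2 * 2 ^ n + 2 * 2 ^ n)%N by lia.
by rewrite [ltnRHS]expnD ltn_pmul2l ?expn_gt0.
Qed.

(** * The query lower bound *)

(** If n <= 2 d, then 2^d <= 2 m gives 2^d <= 4 C d, hence 2^h <= 8 C for h the integer half of d,
    which bounds n by 4 h + 2. *)
Lemma up_log_lt_half C n m : (m <= C * n)%N -> (0 < m)%N -> (32 * C + 2 < n)%N ->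
  (2 * up_log 2 m < n)%N.
Proof.
move=> mCn m0 nC; rewrite ltnNge; apply/negP => nd; set d := up_log 2 m in nd.
have bd : (2 ^ d <= 4 * C * d)%N.
  apply: leq_trans (expn_up_log_le m0) _; apply: (@leq_trans (2 * (C * n))); first lia.
  by have := leq_mul (leqnn C) nd; lia.
pose h := d./2; have dh := odd_double_half d.
have h2 : (h < 2 ^ h)%N by apply: ltn_expl.
have dle : (d <= 2 * h + 1)%N by rewrite /h; case: (odd d) dh => /=; lia.
have hd : (2 ^ h * 2 ^ h <= 2 ^ d)%N by rewrite -expnD leq_exp2l // addnn -[leqRHS]dh leq_addl.
have : (2 ^ h * 2 ^ h <= 8 * C * 2 ^ h)%N.
  apply: leq_trans hd _; apply: leq_trans bd _.
  have : (d <= 2 * 2 ^ h)%N by lia.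
  by move=> dd; have := leq_mul (leqnn (4 * C)%N) dd; lia.
rewrite leq_pmul2r ?expn_gt0 // => hC; lia.
Qed.

(** With at most 2^d queries the average acceptance probabilities over g and over f0 + g coincide,
    yet one is at least 2/3 and the other at most 1/3. *)
Lemma query_complexity_gt (R : realType) n d (T : ralg R n) : (2 * d < n)%N ->
  (forall f : bfun n,
    (f \in RM d n -> 2 / 3 <= accept_prob T f) /\
    (1 / 16 <= dist_to R f (RM d n) -> 2 / 3 <= reject_prob T f)) ->
  (2 ^ d < query_complexity T)%N.
Proof.
move=> dn tester; rewrite ltnNge; apply/negP => small.
have [f0 far] := exists_far dn.
have := sum_accept_translate f0 small.
have card0 : 0 < #|RM d n|%:R :> R.
  rewrite ltr0n; apply/card_gt0P; exists 0; apply/RM_deglt.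
  by apply: eq_deglt (deglt_zero n _) => x; rewrite ffunE.
have : #|RM d n|%:R * (2 / 3) <= \sum_(g in RM d n) accept_prob T g.
  rewrite mulr_natl -sumr_const; apply: ler_sum => g dg.
  by have [acc _] := tester g; apply: acc.
have : \sum_(g in RM d n) accept_prob T (f0 + g) <= #|RM d n|%:R * (1 / 3).
  rewrite mulr_natl -sumr_const; apply: ler_sum => g dg.
  have [_ rej] := tester (f0 + g).
  have : 2 / 3 <= reject_prob T (f0 + g).
    apply: rej; apply/dist_to_ge => [|g' dg']; first by lra.
    (* By linearity of the code, f0 + g is as far from it as f0. *)
    have dg'g : g' - g \in RM d n.
      move/RM_deglt: dg => dg; move/RM_deglt: dg' => dg'; apply/RM_deglt.
      by apply: eq_deglt (degltB dg' dg) => x; rewrite !ffunE.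
    rewrite distE ler_pdivlMr ?exprn_gt0 //.
    have -> : ndiff (f0 + g) g' = ndiff f0 (g' - g).
      by apply: eq_card => x; rewrite !inE !ffunE eq_sym -subr_eq eq_sym.
    have : 2 ^+ n <= 16 * (ndiff f0 (g' - g))%:R :> R.
      by rewrite -natrX -natrM ler_nat far.
    by lra.
  by have := accept_reject T (f0 + g); lra.
by lra.
Qed.

Lemma RM_not_testable (R : realType) (q : nat -> nat) :
  (forall n : nat, (0 < n)%N -> (0 < q n)%N) ->
  (exists C : nat, forall n : nat, (0 < n)%N -> (q n <= C * n)%N) ->
  not_testable_o R (fun n => RM (up_log 2 (q n)) n) q.
Proof.
move=> q0 [C qC]; exists (1 / 16); split; first by lra.
(* A ratio eventually below 1 is already contradictory: for large n the query complexity exceeds 2^d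
   >= q n. *)
case=> T [tester]; move/cvgrPdist_lt => /(_ 1 ltr01) [n0 _ small].
pose n := (maxn n0 (32 * C + 3))%N.
have n_gt0 : (0 < n)%N by rewrite /n; lia.
have dn : (2 * up_log 2 (q n) < n)%N.
  by apply: (up_log_lt_half (qC n n_gt0) (q0 n n_gt0)); rewrite /n; lia.
have big := query_complexity_gt dn (tester n n_gt0).
have := small n (leq_maxl _ _); rewrite /= sub0r normrN.
rewrite ger0_norm ?divr_ge0 // ltr_pdivrMr ?ltr0n ?q0 // mul1r ltr_nat.
move/(ltn_trans big); rewrite ltnNge => /negP; apply.
exact: up_logP.
Qed.

Theorem theorem5 (R : realType) (q : nat -> nat)
    (q_gt0 : forall n : nat, (0 < n)%N -> (0 < q n)%N)
    (q_linear : exists C : nat, forall n : nat, (0 < n)%N -> (q n <= C * n)%N) :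
  let F : ensemble := fun n => RM (up_log 2 (q n)) n in
  affine_invariant F /\
  one_sided_testable_O R F q /\
  not_testable_o R F q.
Proof.
split; first exact: RM_affine_invariant.
by split; [apply: RM_one_sided_testable | apply: RM_not_testable].
Qed.
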